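(* Let $0<\beta<1$, $k_n=\lfloor\exp(2^{\beta n})\rfloor$, and assume these satisfy $k_{n-1}\le k_n\le k_{n-1}^2$ for all $n\ge1$. Let $\mu$ be the stationary mean of the RHA process with these perplexities and $F=\mu(\cdot|\mathcal I)$ its random ergodic measure. Let $C$ be any uniquely decodable binary code for blocks, i.e. for each $m$ an injective map $C:\{1,\dots,k_0\}^m\to\{0,1\}^*$ whose image is uniquely decodable, with length $|C(\cdot)|$. Then $$\mathbb E_\mu\frac{\mathbb E_F|C(\xi_{1:m})|}{H_F(m)}=\Omega\Big(\frac{m^{1-\beta}}{(\log m)^{1/\beta-1}}\Big)\quad (m\to\infty).$$
   Context: Random hierarchical association (RHA) process. Fix positive integers $(k_n)_{n\ge0}$ (perplexities) with $k_{n-1}\le k_n\le k_{n-1}^2$ for all $n\ge1$. On a probability space $(\Omega,\mathcal J,P)$ let, for each $n\ge1$, $(L_{nj},R_{nj})_{j=1}^{k_n}$ be the lexicographically sorted enumeration of a uniformly random $k_n$-element subset of $\{1,\dots,k_{n-1}\}^2$ (each of the $\binom{k_{n-1}^2}{k_n}$ subsets equally likely), independently over $n$. Let $(C_n)_{n\ge0}$ be independent, independent of all $(L_{nj},R_{nj})$, with $C_n$ uniform on $\{1,\dots,k_n\}$. Define strings $Y^0_j=j$ (length 1) for $1\le j\le k_0$ and $Y^n_j=Y^{n-1}_{L_{nj}}Y^{n-1}_{R_{nj}}$ (concatenation). The RHA process is $\mathcal X=Y^0_{C_0}Y^1_{C_1}Y^2_{C_2}\cdots=X_1X_2X_3\cdots$,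 $X_{k:l}=X_k\cdots X_l$. The limits $\mu(x_{1:m})=\lim_{N\to\infty}\frac1N\sum_{i=1}^NP(X_{i:i+m-1}=x_{1:m})$ exist for all finite strings and define a stationary probability measure $\mu$ on $\{1,\dots,k_0\}^{\mathbb N}$ (the stationary mean), with coordinate maps $\xi_i$. $\mathcal I$ is the shift-invariant $\sigma$-algebra, $F=\mu(\cdot|\mathcal I)$ a regular conditional probability, $H_F(m)=\mathbb E_F[-\log F(\xi_{1:m})]$ (a ratio with $H_F(m)=0$ is interpreted as $+\infty$). *)

(* Defs.v *)
From HB Require Import structures.
From mathcomp Require Import all_boot all_order all_algebra.
From mathcomp Require Import all_classical all_reals all_analysis.
From mathcomp Require Import measurable_realfun.
Set Implicit Arguments. Unset Strict Implicit. Unset Printing Implicit Defensive.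
Import Order.TTheory GRing.Theory Num.Theory.
Import numFieldNormedType.Exports.
Local Open Scope classical_set_scope.
Local Open Scope ring_scope.

Definition kRHA (R : realType) (beta : R) (n : nat) : nat :=
  Num.truncn (expR (powR 2 (beta * n%:R))).

Section RHA.
Variable k : nat -> nat.

(* values of the n-th random subset of {0..k_{n-1}-1}^2 (0-based indices) *)
Definition Sset (n : nat) := {set ('I_(k n.-1) * 'I_(k n.-1))}.

Definition lexle (p q : nat * nat) : bool :=
  (p.1 < q.1)%N || ((p.1 == q.1) && (p.2 <= q.2)%N).

Definition pairs_of (n : nat) (s : Sset n) : seq (nat * nat) :=
  sort lexle [seq (nat_of_ord p.1, nat_of_ord p.2) | p <- enum s].

Fixpoint Ystr (pr : nat -> seq (nat * nat)) (n j : nat) : seq nat :=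
  match n with
  | 0 => [:: j]
  | n'.+1 => let p := nth (0, 0)%N (pr n'.+1) j in
             Ystr pr n' p.1 ++ Ystr pr n' p.2
  end.

(* X_i (1-based i >= 1) of  X = Y^0_{C_0} Y^1_{C_1} Y^2_{C_2} ...,
   computed from the prefix Y^0_{C_0} ... Y^i_{C_i} (length 2^(i+1)-1 >= i) *)
Definition Xseq (s : forall n, Sset n) (c : nat -> nat) (i : nat) : nat :=
  nth 0%N (flatten [seq Ystr (fun n => pairs_of (s n)) n (c n) | n <- iota 0 i.+1])
      i.-1.

End RHA.

(* alphabet {0,..,k0-1} (0-based version of {1,..,k0}); k0 >= 1 so this is 'I_k0 *)
Definition Alph (k0 : nat) := 'I_(k0.-1).+1.

Section Laws.
Variables (R : realType) (k : nat -> nat).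
Variables (d : measure_display) (Om : measurableType d) (P : probability Om R).

Definition RHA_law (S : forall n, Om -> Sset k n) (Cc : forall n, Om -> 'I_(k n)) :
    Prop :=
  [/\ (forall n (B : set (Sset k n)), measurable (S n @^-1` B)),
      (forall n (B : set 'I_(k n)), measurable (Cc n @^-1` B)),
      (forall n (s : Sset k n), (1 <= n)%N ->
          fine (P (S n @^-1` [set s])) =
          if #|s| == k n then ('C((k n.-1) ^ 2, k n))%:R^-1 else 0),
      (forall n (c : 'I_(k n)), fine (P (Cc n @^-1` [set c])) = (k n)%:R^-1)
    & (forall (N : nat) (B : forall n, set (Sset k n)) (D : forall n, set 'I_(k n)),
          fine (P [set w | (forall n, (1 <= n <= N)%N -> B n (S n w)) /\
                           (forall n, (n <= N)%N -> D n (Cc n w))]) =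
          (\prod_(1 <= n < N.+1) fine (P (S n @^-1` B n))) *
          (\prod_(n < N.+1) fine (P (Cc n @^-1` D n))))].

Definition window_prob (S : forall n, Om -> Sset k n) (Cc : forall n, Om -> 'I_(k n))
    (m : nat) (x : m.-tuple (Alph (k 0))) (i : nat) : R :=
  fine (P [set w | forall t : 'I_m,
             Xseq (fun n => S n w) (fun n => nat_of_ord (Cc n w)) (i + t) =
             nat_of_ord (tnth x t)]).
End Laws.

HB.instance Definition _ (n : nat) := isPointed.Build 'I_n.+1 ord0.

Definition cyl (k0 m : nat) (x : m.-tuple (Alph k0)) : set (nat -> Alph k0) :=
  [set xi | forall t : 'I_m, xi t = tnth x t].

Definition cylinders (k0 : nat) : set (set (nat -> Alph k0)) :=
  [set A | exists m (x : m.-tuple (Alph k0)), A = cyl x].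

Arguments cylinders k0 : clear implicits.

Definition Xi (k0 : nat) := g_sigma_algebraType (cylinders k0).

Definition shift (k0 : nat) (xi : Xi k0) : Xi k0 := fun t => xi t.+1.

Arguments shift k0 : clear implicits.

Definition invariant_sets (k0 : nat) : set (set (Xi k0)) :=
  [set A | measurable A /\ shift k0 @^-1` A = A].
Arguments invariant_sets k0 : clear implicits.

Section Cond.
Variables (R : realType) (k0 : nat).

Definition is_reg_cond_prob_inv (mu : probability (Xi k0) R)
    (F : Xi k0 -> probability (Xi k0) R) : Prop :=
  forall B : set (Xi k0), measurable B ->
    (forall Y : set (\bar R), measurable Y ->
        invariant_sets k0 ((fun xi => F xi B) @^-1` Y)) /\
    (forall A, invariant_sets k0 A ->
        (\int[mu]_(xi in A) F xi B = mu (A `&` B))%E).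

Definition Fcyl (F : Xi k0 -> probability (Xi k0) R) (xi : Xi k0) (m : nat)
    (x : m.-tuple (Alph k0)) : R := fine (F xi (cyl x)).

Definition xlnx (p : R) : R := if p == 0 then 0 else p * ln p.

Definition H_F (F : Xi k0 -> probability (Xi k0) R) (m : nat) (xi : Xi k0) : R :=
  \sum_(x : m.-tuple (Alph k0)) - xlnx (Fcyl F xi x).

Definition EF_len (F : Xi k0 -> probability (Xi k0) R)
    (C : forall m, m.-tuple (Alph k0) -> seq bool) (m : nat) (xi : Xi k0) : R :=
  \sum_(x : m.-tuple (Alph k0)) Fcyl F xi x * (size (C m x))%:R.

Definition code_ratio (F : Xi k0 -> probability (Xi k0) R)
    (C : forall m, m.-tuple (Alph k0) -> seq bool) (m : nat) (xi : Xi k0) : \bar R :=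
  if H_F F m xi == 0 then +oo%E else (EF_len F C m xi / H_F F m xi)%:E.
End Cond.

Definition uniquely_decodable (W : set (seq bool)) : Prop :=
  forall us vs : seq (seq bool),
    (forall u, u \in us -> W u) -> (forall v, v \in vs -> W v) ->
    flatten us = flatten vs -> us = vs.

Definition UD_block_code (k0 : nat) (C : forall m, m.-tuple (Alph k0) -> seq bool) : Prop :=
  forall m, injective (C m) /\ uniquely_decodable (range (C m)).

(* Main.v *)
Require Import Defs.
From HB Require Import structures.
From mathcomp Require Import all_boot all_order all_algebra.
From mathcomp Require Import all_classical all_reals all_analysis.
From mathcomp Require Import measurable_realfun.
From mathcomp Require Import zify ring lra.
Set Implicit Arguments. Unset Strict Implicit. Unset Printing Implicit Defensive.
Import Order.TTheory GRing.Theory Num.Theory.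
Import numFieldNormedType.Exports.
Local Open Scope classical_set_scope.
Local Open Scope ring_scope.

(** Every window of length [m >= 2^(n+1)] of the RHA process contains a whole
    aligned block [Y^n_J] with [J] uniform.  Expanded down to a level [r] with
    [8 * 4^(n-r) <= k_r], i.e. [2^(beta r)] of order [n], this block is given by
    [2^(n-r)] level-[r] indices, which are distinct with probability at least
    [3/4] and, when distinct, uniformly distributed.  Hence a set of at most
    [k_r^(2^(n-r)) / 8] words of length [m] has [mu]-measure at most [1/2], and
    the [mu]-mean length of an injective binary code is at least of order
    [2^(n-r) * ln k_r], that is [m / (ln m)^(1/beta - 1)].

    In the other direction a tail of the process is a concatenation of blocks
    [Y^n_j], so [mu]-almost every sequence has at most [2^n * k_n^2] distinct
    words of length [m <= 2^n].  By Poincare recurrence [F] only charges words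
    occurring in the sequence, so [H_F(m) <= ln (2^n * k_n^2)], which is of order
    [m^beta].  Dividing the two bounds gives the theorem. *)

(** * Blocks of the process as expanded index sequences *)

(** The two bounds combine because the entropy bound is deterministic: the code length then matters
    only in the mean, where integrating [F] gives back [mu]. The exponent comes from a trade-off in
    [r]. The [2^(n-r)] indices are worth about [2^(beta r)] each, so every further level down gains
    a factor [2^(1-beta)]; the birthday bound stops the descent, since distinctness needs [4^(n-r)]
    small against [k_r]. Stopping at [2^r] of order [n^(1/beta)] leaves [2^n / n^(1/beta - 1)]. Two
    features of the hypotheses shape the statements. Independence is a product formula on
    rectangles, so the laws used in the descent are stated jointly with an arbitrary event
    [rect r B] on the subsets of levels 1 to [r]; this lets an induction go down one level at a
    time. The measure [mu] is known only through Cesaro limits on cylinders, so facts about the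
    process enter as bounds uniform in the position or as identities valid from some position on. *)

Definition down (pr : seq (nat * nat)) (us : seq nat) : seq nat :=
  flatten [seq [:: (nth (0, 0)%N pr u).1; (nth (0, 0)%N pr u).2] | u <- us].

(* [lev pr r d us] expands a sequence of level-[r + d] indices into the
   sequence of the level-[r] indices it stands for. *)
Fixpoint lev (pr : nat -> seq (nat * nat)) (r d : nat) (us : seq nat) : seq nat :=
  if d is d'.+1 then lev pr r d' (down (pr (r + d').+1) us) else us.

Section Descent.
Local Open Scope nat_scope.
Implicit Types (pr : nat -> seq (nat * nat)) (us vs : seq nat).

Lemma down_cat p us vs : down p (us ++ vs) = down p us ++ down p vs.
Proof. by rewrite /down map_cat flatten_cat. Qed.

Lemma size_down p us : size (down p us) = (size us).*2.
Proof. by elim: us => //= u us IH; rewrite /= -/(down p us) IH. Qed.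

Lemma nth_down p us e : e < (size us).*2 ->
  nth 0 (down p us) e =
  let q := nth (0, 0) p (nth 0 us e./2) in if odd e then q.2 else q.1.
Proof.
elim: us e => //= u us IH [|[|e]] //=.
rewrite doubleS !ltnS => /IH; rewrite /down /= => ->.
by rewrite negbK.
Qed.

(** [lev] recurses on the top level; the laws below peel off the lowest level instead, which this
    form allows. *)
Lemma lev_rec pr r d us : lev pr r d.+1 us = down (pr r.+1) (lev pr r.+1 d us).
Proof.
elim: d us => [|d IH] us; first by rewrite /= addn0.
by rewrite -[LHS]/(lev pr r d.+1 (down (pr (r + d.+1).+1) us)) IH /= addSnnS.
Qed.

Lemma size_lev pr r d us : size (lev pr r d us) = size us * 2 ^ d.
Proof.
elim: d us => [|d IH] us /=; first by rewrite muln1.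
by rewrite IH size_down expnS -muln2 mulnA.
Qed.

Lemma lev_cat pr r d us vs :
  lev pr r d (us ++ vs) = lev pr r d us ++ lev pr r d vs.
Proof. by elim: d us vs => [|d IH] us vs //=; rewrite down_cat IH. Qed.

Lemma lev_split pr r n d us :
  lev pr r (n + d) us = lev pr r n (lev pr (r + n) d us).
Proof.
elim: d us => [|d IH] us; first by rewrite addn0.
by rewrite addnS /= IH addnA.
Qed.

Lemma Ystr_lev pr n j : Ystr pr n j = lev pr 0 n [:: j].
Proof.
elim: n j => //= n IH j; rewrite add0n.
rewrite !IH /down /= -(lev_cat pr 0 n [:: _] [:: _]).
by [].
Qed.

Lemma nth_lev_block pr r d us e t : e < size us -> t < 2 ^ d ->
  nth 0 (lev pr r d us) (e * 2 ^ d + t) = nth 0 (lev pr r d [:: nth 0 us e]) t.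
Proof.
elim: us e => //= u us IH [|e] /= es td; rewrite -cat1s lev_cat nth_cat size_lev mul1n.
  by rewrite mul0n add0n td.
by rewrite ltnNge mulSn -addnA leq_addr /= addKn IH.
Qed.

Lemma down_lt p (k : nat) us : 0 < k -> all (fun q => (q.1 < k) && (q.2 < k)) p ->
  all (fun u => u < k) (down p us).
Proof.
move=> k0 hp; elim: us => //= u us IH; rewrite /= -/(down p us) IH andbT.
have [us1|us1] := ltnP u (size p); last by rewrite nth_default ?k0.
by have /(all_nthP (0, 0)) /(_ u us1) := hp.
Qed.

Lemma lev_lt pr (k : nat -> nat) r d us :
    (forall n, 0 < k n) ->
    (forall n, all (fun q => (q.1 < k n) && (q.2 < k n)) (pr n.+1)) ->
  all (fun u => u < k (r + d)) us -> all (fun u => u < k r) (lev pr r d us).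
Proof.
move=> k0 hp; case: d => [|d]; first by rewrite addn0.
by rewrite lev_rec => _; apply: down_lt.
Qed.

(* Index of the level-[n] string at the positions [a * 2 ^ n <= i < (a + 1) * 2 ^ n]
   of the process, which never straddle two of its top-level strings; the bits
   of [a] select the path from the top-level index. *)
Definition block_index_of pr (c : nat -> nat) n a :=
  let d := trunc_log 2 a in nth 0 (lev pr n d [:: c (n + d)]) (a - 2 ^ d).

Lemma trunc_log_block n a t : 0 < a -> t < 2 ^ n ->
  trunc_log 2 (a * 2 ^ n + t) = n + trunc_log 2 a.
Proof.
move=> a0 tn; apply: trunc_log_eq => //.
have /andP[h1 h2] := trunc_log_bounds (isT : 1 < 2) a0.
rewrite expnD [2 ^ n * _]mulnC; apply/andP; split.
  by rewrite (leq_trans (leq_mul h1 (leqnn _))) // leq_addr.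
apply: (@leq_trans (a.+1 * 2 ^ n)).
  by rewrite mulSn addnC ltn_add2r.
by rewrite -addnS expnD mulnC leq_pmul2l ?expn_gt0.
Qed.

(** So [Y^N] fills the 1-based positions [2^N] to [2^(N+1) - 1], and [trunc_log 2 i] is the level of
    the string containing position [i]. *)
Lemma flatten_prefix pr (c : nat -> nat) N :
  size (flatten [seq Ystr pr n (c n) | n <- iota 0 N]) = (2 ^ N).-1.
Proof.
elim: N => // N IH; rewrite -addn1 iotaD map_cat flatten_cat size_cat IH /= cats0.
rewrite Ystr_lev size_lev mul1n add0n addn1 expnS mul2n -addnn.
by case: (2 ^ N) (expn_gt0 2 N).
Qed.

Lemma nth_prefix pr (c : nat -> nat) i : 0 < i ->
  nth 0 (flatten [seq Ystr pr n (c n) | n <- iota 0 i.+1]) i.-1 =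
  let N := trunc_log 2 i in nth 0 (Ystr pr N (c N)) (i - 2 ^ N).
Proof.
move=> i0; have /andP[h1 h2] := trunc_log_bounds (isT : 1 < 2) i0.
set N := trunc_log 2 i in h1 h2 *.
have Ni : N <= i by rewrite ltnW // (leq_trans _ h1) // ltn_expl.
rewrite -(subnKC (leqW Ni)) iotaD map_cat flatten_cat nth_cat flatten_prefix.
have -> : (i.-1 < (2 ^ N).-1) = false.
  by have := expn_gt0 2 N; lia.
rewrite add0n subSn //= nth_cat Ystr_lev size_lev mul1n.
have -> : i.-1 - (2 ^ N).-1 = i - 2 ^ N by have := expn_gt0 2 N; lia.
by rewrite ifT // ltn_subLR // addnn -mul2n -expnS.
Qed.

(** The condition [0 < a] leaves out the positions below [2^n], which belong to strings shorter than
    a block. *)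
Lemma nth_prefix_block pr (c : nat -> nat) n a t : 0 < a -> t < 2 ^ n ->
  nth 0 (flatten [seq Ystr pr n (c n) | n <- iota 0 (a * 2 ^ n + t).+1])
    (a * 2 ^ n + t).-1 = nth 0 (lev pr 0 n [:: block_index_of pr c n a]) t.
Proof.
move=> a0 tn; rewrite nth_prefix ?addn_gt0 ?muln_gt0 ?a0 ?expn_gt0 //=.
rewrite trunc_log_block // /block_index_of Ystr_lev lev_split add0n.
have /andP[h1 h2] := trunc_log_bounds (isT : 1 < 2) a0.
set d := trunc_log 2 a in h1 h2 *.
rewrite -nth_lev_block //; last first.
  by rewrite size_lev mul1n ltn_subLR // addnn -mul2n -expnS.
by congr (nth 0 _ _); rewrite mulnBl expnD [2 ^ n * 2 ^ d]mulnC addnBAC // leq_mul2r h1 orbT.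
Qed.

End Descent.

(** * Sorted enumerations and supersets *)

(** Expansion factors into a lookup, which depends on the random subset, and this injective
    flattening. *)
Definition unpair (z : seq (nat * nat)) : seq nat :=
  flatten [seq [:: q.1; q.2] | q <- z].

Section Pairs.
Local Open Scope nat_scope.

Lemma down_unpair p us : down p us = unpair [seq nth (0, 0) p u | u <- us].
Proof. by rewrite /down /unpair -map_comp. Qed.

Lemma unpair_inj : injective unpair.
Proof.
elim=> [|[a b] z IH] [|[a' b'] z'] //= [-> ->].
by rewrite -!/(unpair _) => /IH ->.
Qed.

Lemma unpair_surj q v : size v = q.*2 -> exists2 z, v = unpair z & size z = q.
Proof.
elim: q v => [|q IH] [|a [|b v]] //=; first by move=> _; exists [::].
rewrite doubleS => -[] /IH[z -> <-]; by exists ((a, b) :: z).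
Qed.

Lemma unpair_uniq z : uniq (unpair z) -> uniq z.
Proof.
elim: z => //= -[a b] z IH /=; rewrite -/(unpair z) inE negb_or.
move=> /and3P[/andP[_ az] _ /IH ->]; rewrite andbT.
apply: contra az => abz; apply/flattenP; exists [:: a; b]; last by rewrite inE eqxx.
by apply/mapP; exists (a, b).
Qed.

Lemma all_unpair (P : pred nat) z :
  all P (unpair z) = all (fun q => P q.1 && P q.2) z.
Proof. by elim: z => //= -[a b] z; rewrite -/(unpair z) => <-; rewrite andbA. Qed.

(** A duplicate-free [p] makes the lookup invertible, so its result determines the indices. *)
Lemma map_nth_index (T : eqType) (x0 : T) (p z : seq T) us :
  uniq p -> all (fun u => u < size p) us ->
  ([seq nth x0 p u | u <- us] == z) =
  all (mem p) z && (us == [seq index x p | x <- z]).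
Proof.
move=> up; elim: us z => [|u us IH] [|x z] //=; first by rewrite andbF.
move=> /andP[u1 us1]; rewrite !eqseq_cons IH //.
apply/idP/idP => [/andP[/eqP <- /andP[-> /eqP ->]]|].
  by rewrite mem_nth // index_uniq // !eqxx.
by move=> /andP[/andP[xp ->] /andP[/eqP -> ->]]; rewrite nth_index // eqxx.
Qed.

Variable k : nat -> nat.
Implicit Types n : nat.

Lemma pair_of_ord_inj a : injective (fun p : 'I_a * 'I_a => (nat_of_ord p.1, nat_of_ord p.2)).
Proof. by move=> [a1 b] [c e] [] /val_inj -> /val_inj ->. Qed.

Lemma pairs_of_uniq n (s : Sset k n) : uniq (pairs_of s).
Proof. by rewrite sort_uniq map_inj_uniq ?enum_uniq //; apply: pair_of_ord_inj. Qed.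

Lemma size_pairs_of n (s : Sset k n) : size (pairs_of s) = #|s|.
Proof. by rewrite size_sort size_map cardE. Qed.

Lemma mem_pairs_of n (s : Sset k n) p :
  ((nat_of_ord p.1, nat_of_ord p.2) \in pairs_of s) = (p \in s).
Proof.
by rewrite mem_sort (mem_map (@pair_of_ord_inj _)) mem_enum.
Qed.

Lemma pairs_of_lt n (s : Sset k n) :
  all (fun q => (q.1 < k n.-1) && (q.2 < k n.-1)) (pairs_of s).
Proof.
apply/allP => x; rewrite mem_sort => /mapP[p _ ->] /=.
by rewrite !ltn_ord.
Qed.

(** Removing [Z] is a bijection onto the subsets of its complement with [c - #|Z|] elements. *)
Lemma card_supersets (T : finType) (Z : {set T}) (c : nat) : #|Z| <= c ->
  #|[set s : {set T} | (Z \subset s) && (#|s| == c)]%SET| = 'C(#|T| - #|Z|, c - #|Z|).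
Proof.
move=> Zc; have <- : #|(~: Z)%SET| = #|T| - #|Z| by rewrite cardsCs finset.setCK.
rewrite -cards_draws.
have inj : {in [set s : {set T} | (Z \subset s) && (#|s| == c)]%SET &,
    injective (fun s : {set T} => s :\: Z)}.
  move=> s s'; rewrite !inE => /andP[h _] /andP[h' _] e.
  by rewrite -(finset.setID s Z) -(finset.setID s' Z) e (finset.setIidPr h) (finset.setIidPr h').
rewrite -(card_in_imset inj); apply: eq_card => A.
rewrite inE; apply/imsetP/andP => [[s]|[AZ /eqP Ac]].
  rewrite inE => /andP[h /eqP <-] ->; rewrite finset.setDE finset.subsetIr; split=> //.
  by rewrite -finset.setDE cardsD (finset.setIidPr h).
have dAZ : (A :&: Z)%SET = finset.set0.
  by apply/eqP; rewrite finset.setI_eq0 finset.disjoints_subset.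
exists (A :|: Z)%SET.
  rewrite inE finset.subsetUr; have := cardsUI A Z.
  by rewrite dAZ cards0 addn0 => ->; rewrite Ac subnK ?eqxx.
rewrite finset.setDUl finset.setDv finset.setU0; apply/esym/finset.setDidPl.
by rewrite -finset.setI_eq0 dAZ.
Qed.

(** The share of [c]-subsets of a [K]-set that contain [q] given points is [c ^_ q / K ^_ q], here
    without division. *)
Lemma bin_ffact_supersets K c q : q <= c -> c <= K ->
  'C(K, c) * c ^_ q = 'C(K - q, c - q) * K ^_ q.
Proof.
move=> qc cK; apply/eqP; rewrite -(eqn_pmul2r (fact_gt0 (c - q))).
rewrite -(eqn_pmul2r (fact_gt0 (K - c))).
have e1 := bin_fact cK; have e2 := ffact_fact qc.
have e3 := ffact_fact (leq_trans qc cK).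
have e4 := bin_fact (leq_sub2r q cK).
have e5 : K - q - (c - q) = K - c by lia.
by rewrite e5 in e4; apply/eqP; rewrite -mulnA -mulnA (mulnA (c ^_ q)) e2 e1 -e3 -e4; ring.
Qed.

End Pairs.

(** * Real-valued probabilities and discrete random variables *)

Section Probability.
Variables (R : realType) (d : measure_display) (Om : measurableType d).
Variable P : probability Om R.

Definition prob (A : set Om) : R := fine (P A).

(** Measurability for the discrete sigma-algebra on the target, which serves sequences, subsets and
    indices alike. *)
Definition dmeas (X : Type) (f : Om -> X) := forall A : set X, measurable (f @^-1` A).

Lemma probK A : measurable A -> (prob A)%:E = P A.
Proof. by move=> mA; rewrite /prob fineK // fin_num_measure. Qed.

Lemma prob_ge0 A : 0 <= prob A.
Proof. by rewrite fine_ge0. Qed.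

Lemma le_prob A B : measurable A -> measurable B -> A `<=` B -> prob A <= prob B.
Proof.
by move=> mA mB AB; rewrite -lee_fin !probK //; apply: le_measure; rewrite ?inE.
Qed.

Lemma prob_le1 A : measurable A -> prob A <= 1.
Proof. by move=> mA; rewrite -lee_fin probK // probability_le1. Qed.

Lemma probT : prob setT = 1.
Proof. by rewrite /prob probability_setT. Qed.

Lemma prob0 : prob set0 = 0.
Proof. by rewrite /prob measure0. Qed.

Lemma probU A B : measurable A -> measurable B -> [disjoint A & B]%classic ->
  prob (A `|` B) = prob A + prob B.
Proof.
move=> mA mB /disj_set2P AB; apply: EFin_inj; rewrite EFinD !probK ?measureU //.
exact: measurableU.
Qed.

Lemma prob_split (X : finType) (f : Om -> X) A : measurable A -> dmeas f ->
  prob A = \sum_(x : X) prob (A `&` [set w | f w = x]).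
Proof.
move=> mA mf; apply: EFin_inj; rewrite -sumEFin.
have mAx x : measurable (A `&` [set w | f w = x]).
  by apply: measurableI => //; exact: (mf [set x]).
under eq_bigr do rewrite probK //.
rewrite probK // -[in LHS](_ : \bigcup_(x in setT) (A `&` [set w | f w = x]) = A).
  rewrite measure_fin_bigcup //=.
    rewrite (fsbigE (index_enum X)) ?index_enum_uniq //.
      by apply: eq_bigl => x; rewrite in_setT.
    by move=> x _; rewrite mem_index_enum.
  by move=> x y _ _ [w [[_ <-] [_ <-]]].
by apply/seteqP; split=> [w [x _ []]|w Aw] //; exists (f w).
Qed.

Lemma dmeas_comp2 (X : countType) Y Z (f : Om -> X) (g : Om -> Y) (h : X -> Y -> Z) :
  dmeas f -> dmeas g -> dmeas (fun w => h (f w) (g w)).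
Proof.
move=> mf mg A.
rewrite (_ : _ @^-1` A =
    \bigcup_x ([set w | f w = x] `&` g @^-1` [set y | A (h x y)])); last first.
  by apply/seteqP; split=> [w Aw|w [x _ []] /= <-]; [exists (f w)|].
apply: countable_bigcupT_measurable => // x.
by apply: measurableI; [exact: (mf [set x])|exact: mg].
Qed.

Lemma dmeas_comp X Z (f : Om -> X) (h : X -> Z) : dmeas f -> dmeas (fun w => h (f w)).
Proof. by move=> mf A; exact: (mf (h @^-1` A)). Qed.

Lemma dmeas_forall (I : finType) X (f : I -> Om -> X) (B : I -> set X) :
  (forall i, dmeas (f i)) -> measurable [set w | forall i, B i (f i w)].
Proof.
move=> mf; rewrite (_ : [set w | _] = \bigcap_(i in setT) (f i @^-1` B i)).
  by apply: fin_bigcap_measurable => [|i _]; [exact: finite_finset|exact: mf].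
by apply/seteqP; split=> [w Bw i _|w Bw i]; [exact: Bw|exact: (Bw i)].
Qed.

End Probability.

(** * One expansion step *)

Section Law.
Variables (R : realType) (k : nat -> nat).
Variables (d : measure_display) (Om : measurableType d) (P : probability Om R).
Variables (S : forall n, Om -> Sset k n) (Cc : forall n, Om -> 'I_(k n)).
Hypothesis hlaw : RHA_law P S Cc.
Hypothesis k_gt0 : forall n, (0 < k n)%N.
Hypothesis k_le : forall n, (k n.+1 <= k n ^ 2)%N.

Local Notation pr := (prob P).

Definition pairs_at (w : Om) (n : nat) := pairs_of (S n w).

Definition rect r (B : forall n, set (Sset k n)) : set Om :=
  [set w | forall n, (1 <= n <= r)%N -> B n (S n w)].

Definition rect_prob r (B : forall n, set (Sset k n)) : R :=
  \prod_(1 <= n < r.+1) pr (S n @^-1` B n).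

Definition index_seq n (T : Om -> seq nat) q :=
  forall w, size (T w) = q /\ all (fun u => (u < k n)%N) (T w).

Lemma dmeasS n : dmeas (S n).
Proof. by case: hlaw => h _ _ _ _ A; exact: h. Qed.

Lemma dmeasC n : dmeas (Cc n).
Proof. by case: hlaw => _ h _ _ _ A; exact: h. Qed.

Lemma prS n (s : Sset k n.+1) : pr (S n.+1 @^-1` [set s]) =
  if #|s| == k n.+1 then ('C(k n ^ 2, k n.+1))%:R^-1 else 0.
Proof. by case: hlaw => _ _ /(_ n.+1 s isT). Qed.

Lemma rectS r B : rect r.+1 B = rect r B `&` S r.+1 @^-1` B r.+1.
Proof.
apply/seteqP; split=> [w h|w [h1 h2] n /andP[n1]].
  split=> [n /andP[n1 n2]|]; apply: h; first by rewrite n1 leqW.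
  by rewrite leqnn.
by rewrite leq_eqVlt => /orP[/eqP ->//|n2]; apply: h1; rewrite n1.
Qed.

Lemma measurable_rect r B : measurable (rect r B).
Proof.
elim: r => [|r IH].
  rewrite (_ : rect 0 B = setT) //; apply/seteqP; split=> // w _ [|n] //.
by rewrite rectS; apply: measurableI => //; apply: dmeasS.
Qed.

Lemma rect_probS r B : rect_prob r.+1 B = rect_prob r B * pr (S r.+1 @^-1` B r.+1).
Proof. by rewrite /rect_prob big_nat_recr. Qed.

Lemma rect_prob_ge0 r B : 0 <= rect_prob r B.
Proof. by apply: prodr_ge0 => n _; apply: prob_ge0. Qed.

Lemma rect_dfwith r B (s : set (Sset k r.+1)) : rect r.+1 (@dfwith _ (fun n => set (Sset k n)) B r.+1 s) =
  rect r B `&` S r.+1 @^-1` s.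
Proof.
rewrite rectS dfwithin; congr (_ `&` _).
by apply/seteqP; split=> w h n nr; move: (h n nr); rewrite dfwithout // gtn_eqF //;
  case/andP: nr.
Qed.

Lemma rect_prob_dfwith r B (s : set (Sset k r.+1)) :
  rect_prob r.+1 (@dfwith _ (fun n => set (Sset k n)) B r.+1 s) =
  rect_prob r B * pr (S r.+1 @^-1` s).
Proof.
rewrite rect_probS dfwithin; congr (_ * _); apply: eq_big_nat => n /andP[_ nr].
by rewrite dfwithout // gtn_eqF.
Qed.

Lemma rectT r : rect r (fun=> setT) = setT.
Proof. by apply/seteqP; split. Qed.

Lemma rect_probT r : rect_prob r (fun=> setT) = 1.
Proof. by rewrite /rect_prob big1_seq // => n _; rewrite preimage_setT probT. Qed.

Lemma top_law N (j : 'I_(k N)) B :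
  pr ([set w | Cc N w = j] `&` rect N B) = (k N)%:R^-1 * rect_prob N B.
Proof.
case: hlaw => _ _ _ hC h.
(* Trivial except at level [N]; equality is taken in [nat] because the type of [c] depends on
   [n]. *)
pose D n : set 'I_(k n) := [set c | n = N -> nat_of_ord c = j].
have := h N B D; rewrite -/(rect_prob N B) big_ord_recr /= big1 ?mul1r.
  rewrite mulrC; set A := _ `&` _; rewrite (_ : [set w | _] = A).
    rewrite -/(pr _) => ->; congr (_ * _); rewrite -(hC N j); congr (fine (P _)).
    apply/seteqP; split=> w /=; last by move=> -> _.
    by move=> /(_ erefl) /val_inj.
  apply/seteqP; split=> w /=.
    move=> [h1 h2]; split; last exact: h1.
    by apply: val_inj; apply: (h2 N).
  by move=> [h1 h2]; split=> // n nN; rewrite /D /= => e; subst n; rewrite h1.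
move=> n _; rewrite (_ : Cc n @^-1` D n = setT) ?probability_setT //.
apply/seteqP; split=> // w _ /= nN.
by have := ltn_ord n; rewrite nN ltnn.
Qed.

Lemma dmeas_down r (T : Om -> seq nat) : dmeas T ->
  dmeas (fun w => down (pairs_at w r) (T w)).
Proof.
move=> mT; have h := @dmeasS r.
exact: (dmeas_comp2 (fun s t => down (pairs_of s) t) h mT).
Qed.

Lemma dmeas_lev r n (T : Om -> seq nat) : dmeas T ->
  dmeas (fun w => lev (pairs_at w) r n (T w)).
Proof. by elim: n T => //= n IH T mT; apply: IH; apply: dmeas_down. Qed.

Lemma index_seq_down r T q : index_seq r.+1 T q ->
  index_seq r (fun w => down (pairs_at w r.+1) (T w)) q.*2.
Proof.
move=> h w; have [h1 h2] := h w; split; first by rewrite size_down h1.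
by apply: down_lt => //; apply: pairs_of_lt.
Qed.

(** Condition on [S r.+1]: a value of the wrong size has probability 0, and for any other value the
    lookup is injective, so the event fixes [T] or is impossible. *)
Lemma down_split r q G T z B : measurable G -> dmeas T -> index_seq r.+1 T q ->
  pr (G `&` [set w | down (pairs_at w r.+1) (T w) = unpair z] `&` rect r B) =
  \sum_(s : Sset k r.+1 | (#|s| == k r.+1) && all (mem (pairs_of s)) z)
   pr (G `&` [set w | T w = [seq index x (pairs_of s) | x <- z]] `&`
      rect r.+1 (@dfwith _ (fun n => set (Sset k n)) B r.+1 [set s])).
Proof.
move=> mG mT hT.
have mA : measurable
    (G `&` [set w | down (pairs_at w r.+1) (T w) = unpair z] `&` rect r B).
  apply: measurableI; last exact: measurable_rect.
  by apply: measurableI => //; exact: (@dmeas_down r.+1 T mT [set unpair z]).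
rewrite (prob_split P mA (@dmeasS r.+1)) [RHS]big_mkcond; apply: eq_bigr => s _.
have [sk|sk] := boolP (#|s| == k r.+1); last first.
  have mS : measurable (S r.+1 @^-1` [set s]) by apply: dmeasS.
  have S0 : pr (S r.+1 @^-1` [set s]) = 0 by rewrite prS (negbTE sk).
  apply/eqP; rewrite eq_le prob_ge0 andbT -S0.
  by apply: le_prob => //; exact: measurableI.
have key w : S r.+1 w = s ->
    (down (pairs_at w r.+1) (T w) == unpair z) = all (mem (pairs_of s)) z &&
    (T w == [seq index x (pairs_of s) | x <- z]).
  move=> ws; rewrite /pairs_at ws down_unpair (inj_eq unpair_inj) map_nth_index //.
    exact: pairs_of_uniq.
  by rewrite size_pairs_of (eqP sk); have [] := hT w.
rewrite rect_dfwith /=; case: ifP => zs.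
  congr (pr _); apply/seteqP; split=> w /=.
    by move=> [[[Gw /eqP dw] rw] ws]; move: dw; rewrite key // zs => /eqP ->.
  by move=> [[Gw Tw] [rw ws]]; split => //; split=> //; split=> //;
    apply/eqP; rewrite key // zs /= Tw.
rewrite (_ : _ `&` _ = set0) ?prob0 //; apply/seteqP; split=> // w /=.
by move=> [[[Gw /eqP dw] rw] ws]; move: dw; rewrite key // zs.
Qed.

(** For each value of [S r.+1] the event allows at most one value of [T], and the probabilities of
    the values of [S r.+1] sum to 1. [G] will be the event that the indices are distinct. *)
Lemma step_le r q G T c : measurable G -> dmeas T -> index_seq r.+1 T q -> 0 <= c ->
  (forall u B, pr (G `&` [set w | T w = u] `&` rect r.+1 B) <= c * rect_prob r.+1 B) ->
  forall v B, pr (G `&` [set w | down (pairs_at w r.+1) (T w) = v] `&` rect r B)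
    <= c * rect_prob r B.
Proof.
move=> mG mT hT c0 h v B.
have [vq|vq] := eqVneq (size v) q.*2; last first.
  rewrite (_ : _ `&` rect r B = set0) ?prob0 ?mulr_ge0 ?rect_prob_ge0 //.
  apply/seteqP; split=> // w /= [[_ vw] _]; case/eqP: vq.
  by rewrite -vw; have [] := index_seq_down hT w.
have [z -> zq] := unpair_surj vq; rewrite (down_split z B mG mT hT).
apply: (@le_trans _ _ (\sum_(s : Sset k r.+1) c * rect_prob r B * pr (S r.+1 @^-1` [set s]))).
  rewrite big_mkcond; apply: ler_sum => s _; case: ifP => _.
    by rewrite (le_trans (h _ _)) // rect_prob_dfwith mulrA.
  by rewrite !mulr_ge0 ?rect_prob_ge0 ?prob_ge0.
rewrite -mulr_sumr ler_piMr ?mulr_ge0 ?rect_prob_ge0 //.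
rewrite le_eqVlt -[X in _ == X](probT P) (prob_split P (@measurableT _ Om) (@dmeasS r.+1)).
by apply/orP; left; apply/eqP/eq_bigr => s _; rewrite setTI.
Qed.

(* Given [S r.+1 = s], the expansion equals [unpair z] for exactly one distinct
   [T] if [s] contains [z], and for none otherwise; this averages to the
   proportion of [k r.+1]-subsets that contain [z]. *)
Lemma step_eq r q T c : dmeas T -> index_seq r.+1 T q ->
  (forall u B, size u = q -> uniq u -> all (fun x => x < k r.+1)%N u ->
    pr ([set w | T w = u] `&` rect r.+1 B) = c * rect_prob r.+1 B) ->
  forall z B, size z = q -> uniq z -> all (fun x => x < k r)%N (unpair z) ->
    pr ([set w | down (pairs_at w r.+1) (T w) = unpair z] `&` rect r B) =
    c * ((k r.+1 ^_ q)%:R / ((k r ^ 2) ^_ q)%:R) * rect_prob r B.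
Proof.
move=> mT hT h z B zq uz zk.
have := down_split z B (@measurableT _ Om) mT hT; rewrite setTI => ->.
rewrite (eq_bigr (fun=> c * rect_prob r B * ('C(k r ^ 2, k r.+1))%:R^-1)); last first.
  move=> s /andP[sk zs]; rewrite setTI h ?size_map //.
  - by rewrite rect_prob_dfwith prS sk mulrA.
  - rewrite map_inj_in_uniq // => x y xz yz e.
    have xs : x \in pairs_of s by move/allP: zs; apply.
    have ys : y \in pairs_of s by move/allP: zs; apply.
    by rewrite -(nth_index (0, 0)%N xs) e nth_index.
  - apply/allP => _ /mapP[x xz ->]; rewrite -(eqP sk) -size_pairs_of index_mem.
    by move/allP: zs; apply.
pose K := (k r ^ 2)%N.
have cT : #|{: 'I_(k r) * 'I_(k r)}| = K by rewrite card_prod card_ord mulnn.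
have [Z eZ] : exists Z : seq ('I_(k r) * 'I_(k r)),
    [seq (nat_of_ord p.1, nat_of_ord p.2) | p <- Z] = z.
  move: zk; rewrite all_unpair; elim: (z) => [|[x y] z' IH] /=; first by exists [::].
  move=> /andP[/andP[xk yk] /IH[Z <-]].
  by exists ((Ordinal xk, Ordinal yk) :: Z).
have uZ : uniq Z by move: uz; rewrite -eZ map_inj_uniq //; apply: pair_of_ord_inj.
have cZ : #|[set:: Z]%SET| = q by rewrite cardsE (card_uniqP uZ) -zq -eZ size_map.
have qK : (q <= K)%N by rewrite -cT -cZ max_card.
rewrite big_const_seq iter_addr_0 -[count _ _]sum1_count sum1_card.
rewrite (_ : #|_| = if (q <= k r.+1)%N then 'C(K - q, k r.+1 - q) else 0%N); last first.
  pose E := [set s : {set 'I_(k r) * 'I_(k r)} |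
    ([set:: Z]%SET \subset s) && (#|s| == k r.+1)]%SET.
  transitivity #|E|.
    apply: eq_card => s; rewrite !inE /= andbC; congr (_ && _).
    rewrite -eZ all_map; apply/idP/idP => [/allP hh|/fintype.subsetP hh].
      apply/fintype.subsetP => p; rewrite inE => /hh /=.
      by rewrite (@mem_pairs_of k r.+1).
    by apply/allP => p pZ /=; rewrite (@mem_pairs_of k r.+1) hh // inE.
  case: leqP => qk; first by rewrite card_supersets cZ // cT.
  apply/eqP; rewrite cards_eq0; apply/eqP/finset.setP => s; rewrite !inE.
  apply/negbTE/negP => /andP[/subset_leq_card + /eqP sk].
  by rewrite cZ sk leqNgt qk.
(* If [q] exceeds [k r.+1], both sides vanish. *)
case: leqP => qk; last by rewrite mulr0n (ffact_small qk) !(mul0r, mulr0).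
have := bin_ffact_supersets qk (k_le r); rewrite -/K.
have KC0 : ('C(K, k r.+1))%:R != 0 :> R by rewrite pnatr_eq0 -lt0n bin_gt0 k_le.
have KF0 : (K ^_ q)%:R != 0 :> R by rewrite pnatr_eq0 -lt0n ffact_gt0.
move=> /(congr1 (fun n => n%:R : R)); rewrite !natrM => e.
rewrite -mulr_natr; apply: (mulIf KC0); apply: (mulIf KF0).
transitivity (c * rect_prob r B * (('C(K - q, k r.+1 - q))%:R * (K ^_ q)%:R)).
  by field.
by rewrite -e; field.
Qed.

End Law.

(** * Distribution of block indices *)

Section UnionBound.
Variables (R : realType) (d : measure_display) (Om : measurableType d).
Variable P : probability Om R.
Local Notation pr := (prob P).

(** Extends [prob_split] to maps into an infinite type, such as [seq nat], whose values come from a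
    finite one. *)
Lemma prob_split_inj (X : finType) Y (i : X -> Y) (f : Om -> Y) A : injective i ->
  measurable A -> dmeas f -> (forall w, exists x, f w = i x) ->
  pr A = \sum_(x : X) pr (A `&` [set w | f w = i x]).
Proof.
move=> inj mA mf fi; pose g w := projT1 (cid (fi w)).
have gE w : f w = i (g w) by rewrite /g; case: cid.
have mg : dmeas g.
  move=> B; rewrite (_ : g @^-1` B = f @^-1` (i @` B)); first exact: mf.
  apply/seteqP; split=> w /=; first by move=> Bw; exists (g w).
  by move=> [x Bx]; rewrite gE => /inj <-.
rewrite (prob_split P mA mg); apply: eq_bigr => x _; congr (pr (_ `&` _)).
apply/seteqP; split=> w /=; first by rewrite gE => ->.
by rewrite gE => /inj.
Qed.

Lemma prob_setU_le A B : measurable A -> measurable B -> pr (A `|` B) <= pr A + pr B.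
Proof.
move=> mA mB; rewrite -lee_fin EFinD !probK //; last exact: measurableU.
by apply: measureU2.
Qed.

Lemma prob_mem_le (Y : eqType) (f : Om -> Y) G (A : seq Y) : measurable G -> dmeas f ->
  pr (G `&` [set w | f w \in A]) <= \sum_(v <- A) pr (G `&` [set w | f w = v]).
Proof.
move=> mG mf; elim: A => [|v A IH].
  by rewrite big_nil (_ : _ `&` _ = set0) ?prob0 //; apply/seteqP; split=> // w [].
rewrite big_cons; apply: le_trans (lerD (lexx _) IH).
have mm (Q : set Y) : measurable (G `&` [set w | Q (f w)]).
  by apply: measurableI => //; exact: (mf Q).
apply: (@le_trans _ _ (pr ((G `&` [set w | f w = v]) `|` (G `&` [set w | f w \in A])))).
  apply: le_prob.
  - exact: (mm [set y | y \in v :: A]).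
  - by apply: measurableU; [exact: (mm [set v])|exact: (mm [set y | y \in A])].
  - by move=> w [Gw]; rewrite /= inE => /orP[/eqP e|e]; [left|right].
by apply: prob_setU_le; [exact: (mm [set v])|exact: (mm [set y | y \in A])].
Qed.

End UnionBound.

(** Birthday bound: the falling factorial over the power is the probability that [m] uniform draws
    from [b] values are distinct. *)
Lemma ffact_ge (R : realFieldType) (b m : nat) : (0 < b)%N ->
  b%:R ^+ m * (1 - (m ^ 2)%:R / b%:R) <= (b ^_ m)%:R :> R.
Proof.
move=> b0; have b0' : 0 < b%:R :> R by rewrite ltr0n.
elim: m => [|m IH]; first by rewrite mul0r subr0 mulr1.
(* When [b <= m ^ 2] the left side is at most 0. *)
have [mb|mb] := ltnP (m ^ 2) b; last first.
  rewrite (le_trans _ (ler0n _ _)) // mulr_ge0_le0 ?exprn_ge0 ?ler0n //.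
  rewrite subr_le0 ler_pdivlMr // mul1r ler_nat (leq_trans mb) //.
  by rewrite leq_exp2r.
rewrite ffactnSr natrM; have mb' : (m <= b)%N.
  by apply: leq_trans (ltnW mb); case: (m) => // m'; rewrite leq_pmulr.
apply: le_trans (ler_wpM2r (ler0n _ _) IH).
rewrite natrB // !natrX -natr1 exprS.
have -> : b%:R ^+ m * (1 - m%:R ^+ 2 / b%:R) * (b%:R - m%:R) =
  b%:R ^+ m * (b%:R - m%:R ^+ 2 - m%:R + m%:R ^+ 3 / b%:R) :> R.
  by field; rewrite gt_eqF.
have -> : b%:R * b%:R ^+ m * (1 - (m%:R + 1) ^+ 2 / b%:R) =
  b%:R ^+ m * (b%:R - (m%:R + 1) ^+ 2) :> R.
  by field; rewrite gt_eqF.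
rewrite ler_wpM2l ?exprn_ge0 ?ler0n //.
have : 0 <= m%:R ^+ 3 / b%:R :> R by rewrite divr_ge0 ?exprn_ge0 ?ler0n.
have : 0 <= m%:R :> R by rewrite ler0n.
nra.
Qed.

Lemma ffact_le_exp b m : (b ^_ m <= b ^ m)%N.
Proof.
by elim: m => // m IH; rewrite ffactnSr expnSr leq_mul // leq_subr.
Qed.

(** The ratio is the share, among sequences of [q] distinct pairs, of those whose [2q] entries all
    differ. The denominator is at most [b ^ (2q)], so the birthday bound applies. *)
Lemma ffact_ratio_ge (R : realFieldType) (b q : nat) : (0 < b)%N ->
  1 - (q.*2 ^ 2)%:R / b%:R <= (b ^_ q.*2)%:R / ((b ^ 2) ^_ q)%:R :> R.
Proof.
move=> b0; have b0' : 0 < b%:R :> R by rewrite ltr0n.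
have [bq|bq] := leqP q (b ^ 2); last first.
  rewrite (ffact_small bq) invr0 mulr0 subr_le0 ler_pdivlMr // mul1r ler_nat.
  rewrite (leq_trans (_ : b <= b ^ 2)%N) //; first by rewrite leq_pmulr.
  rewrite (leq_trans (ltnW bq)) // (leq_trans (_ : q <= q.*2)%N) -?addnn ?leq_addr //.
  by case: (q + q)%N => // m'; rewrite leq_pmulr.
have F0 : 0 < ((b ^ 2) ^_ q)%:R :> R by rewrite ltr0n ffact_gt0.
have [h|h] := lerP 0 (1 - (q.*2 ^ 2)%:R / b%:R : R); last first.
  by rewrite (le_trans (ltW h)) // divr_ge0 ?ler0n.
rewrite ler_pdivlMr //; apply: le_trans (ffact_ge R q.*2 b0).
rewrite mulrC ler_wpM2r // -natrX ler_nat -muln2 mulnC expnM.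
exact: ffact_le_exp.
Qed.

(** * Uniformity of a single block index *)

Section Blocks.
Variables (R : realType) (k : nat -> nat).
Variables (d : measure_display) (Om : measurableType d) (P : probability Om R).
Variables (S : forall n, Om -> Sset k n) (Cc : forall n, Om -> 'I_(k n)).
Hypothesis hlaw : RHA_law P S Cc.
Hypothesis k_gt0 : forall n, (0 < k n)%N.
Hypothesis k_le : forall n, (k n.+1 <= k n ^ 2)%N.

Local Notation pr := (prob P).
Local Notation pairs_at := (pairs_at S).
Local Notation rect := (rect S).
Local Notation rect_prob := (rect_prob P S).

Lemma index_seq_lev r n T q : index_seq k (r + n) T q ->
  index_seq k r (fun w => lev (pairs_at w) r n (T w)) (q * 2 ^ n).
Proof.
move=> h w; have [h1 h2] := h w; rewrite size_lev h1; split=> //.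
by apply: lev_lt => // m; apply: pairs_of_lt.
Qed.

(** Induction on the depth: position [e] is one half of the pair looked up at [e./2] one level
    above. A single index is trivially distinct, so [step_eq] with [q = 1] makes that pair
    uniform. *)
Lemma single_law N r n e : N = (r + n)%N -> (e < 2 ^ n)%N ->
  forall j B, (j < k r)%N ->
  pr ([set w | nth 0%N (lev (pairs_at w) r n [:: nat_of_ord (Cc N w)]) e = j] `&` rect r B) =
  (k r)%:R^-1 * rect_prob r B.
Proof.
elim: n r e => [|n IH] r e.
  rewrite addn0 => -> {N}; case: e => // _ j B jk.
  rewrite -(top_law hlaw (Ordinal jk)); congr (pr (_ `&` _)).
  by apply/seteqP; split=> w /= => [e|->] //; apply: val_inj.
rewrite addnS => NE en j B jk.
have {}NE' : N = (r.+1 + n)%N by rewrite NE addSn.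
have e2 : (e./2 < 2 ^ n)%N by rewrite -divn2 ltn_divLR // -expnSr.
pose x w := nth 0%N (lev (pairs_at w) r.+1 n [:: nat_of_ord (Cc N w)]) e./2.
have mx : dmeas x.
  have m0 := dmeas_comp (fun c : 'I_(k N) => [:: nat_of_ord c]) (@dmeasC _ _ _ _ _ _ _ hlaw N).
  exact: (dmeas_comp (fun s => nth 0%N s e./2) (dmeas_lev hlaw r.+1 n m0)).
have hx : index_seq k r.+1 (fun w => [:: x w]) 1.
  move=> w; split=> //=; rewrite andbT.
  have [|s1 s2] := @index_seq_lev r.+1 n (fun w => [:: nat_of_ord (Cc N w)]) 1 _ w.
    by move=> w'; split=> //=; rewrite -NE' ltn_ord.
  by apply: (all_nthP 0%N s2); rewrite s1 mul1n.
have m1 : dmeas (fun w => [:: x w]) by exact: (dmeas_comp (fun y => [:: y]) mx).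
have pairlaw a b B' : (a < k r)%N -> (b < k r)%N ->
    pr ([set w | down (pairs_at w r.+1) [:: x w] = [:: a; b]] `&` rect r B') =
    (k r)%:R^-1 * (k r)%:R^-1 * rect_prob r B'.
  move=> ak bk; have := step_eq hlaw k_le (c := (k r.+1)%:R^-1) m1 hx.
  move=> /(_ _ [:: (a, b)] B' erefl isT) ->; rewrite /= ?ak ?bk //; last first.
    move=> [|u [|]] //= B2 _ _ /andP[uk _]; rewrite -(IH r.+1 e./2 NE' e2 _ _ uk).
    by congr (pr (_ `&` _)); apply/seteqP; split=> w /= => [[]|<-].
  rewrite !ffactn1 natrX; congr (_ * _); field.
  by rewrite !pnatr_eq0 -!lt0n !k_gt0.
pose y w := down (pairs_at w r.+1) [:: x w].
have my : dmeas y := dmeas_down hlaw r.+1 m1.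
have hy w : size (y w) = 2 /\ all (fun u => (u < k r)%N) (y w).
  exact: (index_seq_down S k_gt0 hx w).
(* The other half of the pair, to be summed out over its [k r] values. *)
pose o w := nth 0%N (y w) (~~ odd e).
have mo : dmeas o by exact: (dmeas_comp (fun s => nth 0%N s (~~ odd e)) my).
have ho w : exists i : 'I_(k r), o w = nat_of_ord i.
  have [s1 s2] := hy w; have h : (o w < k r)%N.
    by apply: (all_nthP 0%N s2); rewrite s1; case: odd.
  by exists (Ordinal h).
have yE w : nth 0%N (lev (pairs_at w) r n.+1 [:: nat_of_ord (Cc N w)]) e =
    nth 0%N (y w) (odd e).
  rewrite lev_rec nth_down; last by rewrite size_lev mul1n -ltn_half_double //.
  by rewrite /= -/(x w) /y /down /=; case: odd.
rewrite (prob_split_inj P (@ord_inj (k r)) _ mo ho); last first.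
  apply: measurableI; last exact: (measurable_rect hlaw).
  rewrite (_ : mkset _ = y @^-1` [set s | nth 0%N s (odd e) = j]); first exact: my.
  by apply/seteqP; split=> w /=; rewrite yE.
rewrite (eq_bigr (fun=> (k r)%:R^-1 * (k r)%:R^-1 * rect_prob r B)); last first.
  move=> i _; pose a := if odd e then nat_of_ord i else j.
  pose b := if odd e then j else nat_of_ord i.
  rewrite -(@pairlaw a b); [|by rewrite /a; case: odd|by rewrite /b; case: odd].
  congr (pr _); apply/seteqP; split=> w /=.
    rewrite yE /o /a /b => -[[+ rw] +]; rewrite -/(y w).
    have [+ _] := hy w; case: (y w) => [|u [|v []]] //= _.
    by case: odd => /= -> ->.
  rewrite -/(y w) => -[yw rw]; rewrite yE /o yw /a /b; split; first split => //.
    by case: odd.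
  by case: odd.
rewrite sumr_const card_ord -mulr_natl; field.
by rewrite !pnatr_eq0 -!lt0n !k_gt0.
Qed.

End Blocks.

(** * Joint law of the indices in an expanded block *)

Section Tuples.
Variables (R : realType) (k : nat -> nat).
Variables (d : measure_display) (Om : measurableType d) (P : probability Om R).
Variables (S : forall n, Om -> Sset k n) (Cc : forall n, Om -> 'I_(k n)).
Hypothesis hlaw : RHA_law P S Cc.
Hypothesis k_gt0 : forall n, (0 < k n)%N.
Hypothesis k_le : forall n, (k n.+1 <= k n ^ 2)%N.
Hypothesis k_mono : forall n, (k n <= k n.+1)%N.

Local Notation pr := (prob P).
Local Notation pairs_at := (pairs_at S).
Local Notation rect := (rect S).
Local Notation rect_prob := (rect_prob P S).

(** Nothing is claimed about sequences with repetitions, so [c] times the number of distinct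
    sequences is the probability of distinctness and may be below 1. *)
Definition uniform_distinct r q (T : Om -> seq nat) c :=
  forall u B, size u = q -> uniq u -> all (fun x => x < k r)%N u ->
    pr ([set w | T w = u] `&` rect r B) = c * rect_prob r B.

Lemma prob_uniq r q T c : dmeas T -> index_seq k r T q -> uniform_distinct r q T c ->
  pr [set w | uniq (T w)] = c * (k r ^_ q)%:R.
Proof.
move=> mT hT hc.
pose i (t : q.-tuple 'I_(k r)) := [seq nat_of_ord x | x <- t].
have iinj : injective i by move=> s t /(inj_map (@ord_inj _)) /val_inj.
have Ti w : exists t, T w = i t.
  have [s1 s2] := hT w.
  have [t et] : exists t : seq 'I_(k r), [seq nat_of_ord x | x <- t] = T w.
    elim: (T w) s2 => [|u us IH] /=; first by exists [::].
    by move=> /andP[uk /IH[t <-]]; exists (Ordinal uk :: t).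
  have st : size t == q by rewrite -s1 -et size_map.
  by exists (Tuple st).
have mU : measurable [set w | uniq (T w)] by exact: (mT [set u | uniq u]).
rewrite (prob_split_inj P iinj mU mT Ti) (bigID (fun t : q.-tuple _ => uniq t)) /=.
rewrite [X in _ + X]big1 ?addr0; last first.
  move=> t /negbTE ut; rewrite (_ : _ `&` _ = set0) ?prob0 //.
  apply/seteqP; split=> // w /= [+ Tw].
  by rewrite Tw map_inj_uniq ?ut //; apply: ord_inj.
rewrite (eq_bigr (fun=> c)); last first.
  move=> t ut; have uit : uniq (i t) by rewrite map_inj_uniq //; apply: ord_inj.
  rewrite -[RHS]mulr1 -(rect_probT P S r) -(hc (i t)) ?size_map ?size_tuple //.
    congr (pr _); rewrite rectT; apply/seteqP; split=> w /= [h1 h2]; split=> //.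
    by rewrite h1.
  by apply/allP => _ /mapP[x _ ->].
have cE : #|[pred t : q.-tuple 'I_(k r) | uniq t]| = (k r ^_ q)%N.
  transitivity #|[set t : q.-tuple 'I_(k r) | all predT t & uniq t]%SET|.
    by apply: eq_card => t; rewrite !inE all_predT.
  by rewrite card_uniq_tuples -[in RHS](card_ord (k r)).
by rewrite sumr_const cE mulr_natr.
Qed.

(* With [p r n] the probability of distinctness,
   [p r n.+1 = p r.+1 n * (k r ^_ (2 ^ n.+1)) / ((k r ^ 2) ^_ (2 ^ n))]. *)
Lemma tuple_law r n (J : Om -> nat) : dmeas J -> (forall w, (J w < k (r + n))%N) ->
  (forall j B, (j < k (r + n))%N ->
    pr ([set w | J w = j] `&` rect (r + n) B) = (k (r + n))%:R^-1 * rect_prob (r + n) B) ->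
  exists c : R, [/\ 0 <= c,
    uniform_distinct r (2 ^ n) (fun w => lev (pairs_at w) r n [:: J w]) c &
    1 - 2 * (4 ^ n)%:R / (k r)%:R <= c * (k r ^_ (2 ^ n))%:R].
Proof.
move=> mJ; have mJ1 := dmeas_comp (fun j => [:: j]) mJ.
elim: n r => [|n IH] r hJ hU.
  rewrite addn0 in hJ hU.
  exists (k r)%:R^-1; split.
  - by rewrite invr_ge0.
  - move=> [|u []] // B _ _ /= /andP[uk _]; rewrite -(hU u B uk).
    by congr (pr (_ `&` _)); apply/seteqP; split=> w /= => [[]|->].
  - rewrite expn0 ffactn1 mulVf; last by rewrite pnatr_eq0 -lt0n k_gt0.
    by rewrite lerBlDr lerDl divr_ge0 // mulr_ge0.
rewrite -addSnnS in hJ hU; have [c [c0 hc bc]] := IH r.+1 hJ hU.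
have mT : dmeas (fun w => lev (pairs_at w) r.+1 n [:: J w]) by exact: (dmeas_lev hlaw r.+1 n mJ1).
have hT : index_seq k r.+1 (fun w => lev (pairs_at w) r.+1 n [:: J w]) (2 ^ n).
  rewrite -[X in index_seq _ _ _ X]mul1n; apply: index_seq_lev => // w.
  by rewrite /= hJ.
exists (c * ((k r.+1 ^_ (2 ^ n))%:R / ((k r ^ 2) ^_ (2 ^ n))%:R)); split.
- by rewrite mulr_ge0 // divr_ge0.
- move=> u B su uu ku.
  have su2 : size u = (2 ^ n).*2 by rewrite su expnS mul2n.
  have [z ez zq] := unpair_surj su2; rewrite ez in uu ku *.
  rewrite -(step_eq hlaw k_le mT hT hc B zq (unpair_uniq uu) ku).
  by congr (pr (_ `&` _)); apply/seteqP; split=> w; rewrite /mkset -lev_rec.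
set D := c * (k r.+1 ^_ (2 ^ n))%:R in bc.
have D1 : D <= 1.
  rewrite /D -(prob_uniq mT hT hc); apply: prob_le1.
  exact: (mT [set u | uniq u]).
have D0 : 0 <= D by rewrite mulr_ge0.
set F := ((k r ^ 2) ^_ (2 ^ n))%:R.
have -> : c * ((k r.+1 ^_ (2 ^ n))%:R / F) * (k r ^_ (2 ^ n.+1))%:R =
  D * ((k r ^_ (2 ^ n).*2)%:R / F) by rewrite /D expnS mul2n; ring.
apply: le_trans (ler_wpM2l D0 (ffact_ratio_ge R (2 ^ n) (k_gt0 r))).
have k0 : 0 < (k r)%:R :> R by rewrite ltr0n.
have kk : (k r.+1)%:R^-1 <= (k r)%:R^-1 :> R by rewrite lef_pV2 ?posrE ?ltr0n ?ler_nat.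
have e4 : ((2 ^ n).*2 ^ 2)%:R = 4 * (4 ^ n)%:R :> R.
  by rewrite -mul2n expnMn natrM -[((2 ^ n) ^ 2)%N]expnM [(n * 2)%N]mulnC expnM.
have e4' : (4 ^ n.+1)%:R = 4 * (4 ^ n)%:R :> R by rewrite expnS natrM.
rewrite e4 e4'; set a := (4 ^ n)%:R in bc *.
have a0 : 0 <= a by rewrite ler0n.
set x := (k r)%:R^-1 in kk *; set y := (k r.+1)%:R^-1 in kk bc.
have x0 : 0 <= x by rewrite invr_ge0 ler0n.
(* The loss [2 a y] from above is at most [2 a x], the new step loses at most [4 a x], and their sum
   stays within the [8 a x] allowed by the factor 4 per level. *)
have h1 : a * y <= a * x by rewrite ler_wpM2l.
have h2 : 0 <= a * x by rewrite mulr_ge0.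
nra.
Qed.

(** Below level [r] only the bound on point probabilities is kept, so coincidences there do no
    harm. *)
Lemma descend_le r q G T c : measurable G -> dmeas T -> index_seq k r T q -> 0 <= c ->
  (forall u B, pr (G `&` [set w | T w = u] `&` rect r B) <= c * rect_prob r B) ->
  forall v, pr (G `&` [set w | lev (pairs_at w) 0 r (T w) = v]) <= c.
Proof.
elim: r q T => [|r IH] q T mG mT hT c0 h v.
  have := h v (fun=> setT); rewrite rectT setIT.
  rewrite (rect_probT P S 0) mulr1 => hh; exact: hh.
rewrite [X in G `&` X](_ : _ =
  [set w | lev (pairs_at w) 0 r (down (pairs_at w r.+1) (T w)) = v]) //.
apply: (IH q.*2) => //.
- exact: (dmeas_down hlaw r.+1 mT).
- exact: index_seq_down.
- exact: (step_le hlaw k_gt0 mG mT hT).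
Qed.

(** The first term pays for repetitions at level [r]; without them each expanded word has
    probability at most [c], and a union bound over [A] gives the second. *)
Lemma block_bound r n (J : Om -> nat) : dmeas J -> (forall w, (J w < k (r + n))%N) ->
  (forall j B, (j < k (r + n))%N ->
    pr ([set w | J w = j] `&` rect (r + n) B) = (k (r + n))%:R^-1 * rect_prob (r + n) B) ->
  (2 * 4 ^ n <= k r)%N ->
  forall A : seq (seq nat),
  pr [set w | lev (pairs_at w) 0 (r + n) [:: J w] \in A] <=
    2 * (4 ^ n)%:R / (k r)%:R + (size A)%:R * (2 / (k r)%:R ^+ (2 ^ n)).
Proof.
move=> mJ hJ hU hk A; have [c [c0 hc bc]] := tuple_law mJ hJ hU.
pose T w := lev (pairs_at w) r n [:: J w].
have mJ1 := dmeas_comp (fun j => [:: j]) mJ.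
have mT : dmeas T by exact: (dmeas_lev hlaw r n mJ1).
have hT : index_seq k r T (2 ^ n).
  rewrite -[X in index_seq _ _ _ X]mul1n; apply: index_seq_lev => // w.
  by rewrite /= hJ.
pose G := [set w | uniq (T w)].
have mG : measurable G by exact: (mT [set u | uniq u]).
have prG := prob_uniq mT hT hc.
pose Y w := lev (pairs_at w) 0 r (T w).
have mY : dmeas Y by exact: (dmeas_lev hlaw 0 r mT).
have -> : [set w | lev (pairs_at w) 0 (r + n) [:: J w] \in A] = [set w | Y w \in A].
  by apply/seteqP; split=> w; rewrite /mkset lev_split add0n.
have mA : measurable [set w | Y w \in A] by exact: (mY [set y | y \in A]).
apply: (@le_trans _ _ (pr (~` G) + pr (G `&` [set w | Y w \in A]))).
  have mGA : measurable (G `&` [set w | Y w \in A]) by apply: measurableI.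
  have mGC := measurableC mG.
  apply: le_trans (prob_setU_le P mGC mGA); apply: le_prob => //.
    exact: measurableU.
  by move=> w Yw; have [Gw|Gw] := pselect (G w); [right|left].
have k0 : 0 < (k r)%:R :> R by rewrite ltr0n.
apply: lerD.
  have : pr (G `|` ~` G) = pr G + pr (~` G).
    apply: probU => //; first exact: measurableC.
    by apply/disj_set2P; rewrite setICr.
  by rewrite setUv probT prG; lra.
apply: le_trans (prob_mem_le P A mG mY) _.
(* [c] times the falling factorial is a probability, and [2 * 4^n <= k r] makes the falling
   factorial at least half the power. *)
have cle : c <= 2 / (k r)%:R ^+ (2 ^ n).
  have h1 : c * (k r ^_ (2 ^ n))%:R <= 1 by rewrite -prG prob_le1.
  have h2 := ffact_ge R (2 ^ n) (k_gt0 r).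
  have e4 : ((2 ^ n) ^ 2)%:R = (4 ^ n)%:R :> R by rewrite -expnM mulnC expnM.
  have h3 : (4 ^ n)%:R / (k r)%:R <= 2^-1 :> R.
    rewrite ler_pdivrMr // mulrC ler_pdivlMr // -natrM ler_nat mulnC //.
  rewrite ler_pdivlMr ?exprn_gt0 //; rewrite e4 in h2.
  have p0 : 0 < (k r)%:R ^+ (2 ^ n) :> R by rewrite exprn_gt0.
  set a := (k r)%:R ^+ (2 ^ n) in h2 p0 *; set b := (k r ^_ _)%:R in h1 h2.
  have h4 : a * 2^-1 <= b by apply: le_trans h2; rewrite ler_wpM2l ?(ltW p0) //; lra.
  have := ler_wpM2l c0 h4; lra.
have key v : pr (G `&` [set w | Y w = v]) <= c.
  apply: (descend_le mG mT hT c0) => u B.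
  have [/and3P[/eqP su uu ku]|h] :=
      boolP [&& size u == (2 ^ n)%N, uniq u & all (fun x => x < k r)%N u].
    rewrite -(hc u B su uu ku); apply: le_prob.
    - apply: measurableI; last exact: (measurable_rect hlaw).
      by apply: measurableI => //; exact: (mT [set u]).
    - apply: measurableI; last exact: (measurable_rect hlaw).
      exact: (mT [set u]).
    - by move=> w [[]].
  rewrite (_ : _ `&` rect r B = set0) ?prob0 ?mulr_ge0 ?rect_prob_ge0 //.
  apply/seteqP; split=> // w [[Gw Tw] _]; move/negP: h; apply.
  by have [s1 s2] := hT w; rewrite -Tw s1 eqxx s2 /= andbT.
apply: le_trans (ler_sum _ (fun v _ => key v)) _.
by rewrite big_const_seq count_predT iter_addr_0 -[c *+ _]mulr_natl ler_wpM2l.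
Qed.

End Tuples.

(** * Windows of the process *)

Section Windows.
Variables (R : realType) (k : nat -> nat).
Variables (d : measure_display) (Om : measurableType d) (P : probability Om R).
Variables (S : forall n, Om -> Sset k n) (Cc : forall n, Om -> 'I_(k n)).
Hypothesis hlaw : RHA_law P S Cc.
Hypothesis k_gt0 : forall n, (0 < k n)%N.
Hypothesis k_le : forall n, (k n.+1 <= k n ^ 2)%N.
Hypothesis k_mono : forall n, (k n <= k n.+1)%N.

Local Notation pr := (prob P).
Local Notation pairs_at := (pairs_at S).

Definition block_index n a w := block_index_of (pairs_at w) (fun n => nat_of_ord (Cc n w)) n a.

Definition process w := Xseq (fun n => S n w) (fun n => nat_of_ord (Cc n w)).

Lemma block_index_lt n a w : (0 < a)%N -> (block_index n a w < k n)%N.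
Proof.
move=> a0; have /andP[h1 h2] := trunc_log_bounds (isT : (1 < 2)%N) a0.
rewrite /block_index /block_index_of; set e := trunc_log 2 a in h1 h2 *.
have h3 : all (fun u => u < k n)%N (lev (pairs_at w) n e [:: nat_of_ord (Cc (n + e)%N w)]).
  by apply: lev_lt => //= [m|]; [exact: pairs_of_lt|rewrite ltn_ord].
apply: (all_nthP 0%N h3); rewrite size_lev mul1n ltn_subLR //.
by rewrite addnn -mul2n -expnS.
Qed.

Lemma dmeas_block_index n a : dmeas (block_index n a).
Proof.
have m0 := dmeas_comp (fun c : 'I_(k (n + trunc_log 2 a)) => [:: nat_of_ord c])
  (@dmeasC _ _ _ _ _ _ _ hlaw (n + trunc_log 2 a)).
exact: (dmeas_comp (fun s => nth 0%N s (a - 2 ^ trunc_log 2 a))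
  (dmeas_lev hlaw n (trunc_log 2 a) m0)).
Qed.

Lemma block_index_law n a j B : (0 < a)%N -> (j < k n)%N ->
  pr ([set w | block_index n a w = j] `&` rect S n B) = (k n)%:R^-1 * rect_prob P S n B.
Proof.
move=> a0 jk; have /andP[h1 h2] := trunc_log_bounds (isT : (1 < 2)%N) a0.
apply: (single_law hlaw k_gt0 k_le (e := (a - 2 ^ trunc_log 2 a)%N)
  (erefl (n + trunc_log 2 a)%N)) => //.
by rewrite ltn_subLR // addnn -mul2n -expnS.
Qed.

Lemma process_block w n a t : (0 < a)%N -> (t < 2 ^ n)%N ->
  process w (a * 2 ^ n + t) = nth 0%N (lev (pairs_at w) 0 n [:: block_index n a w]) t.
Proof. exact: nth_prefix_block. Qed.

Lemma process0 w i : (0 < i)%N -> process w i = block_index 0 i w.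
Proof. by move=> i0; have := @process_block w 0 i 0 i0 isT; rewrite muln1 addn0. Qed.

(** For [i > 0] the process values are below [k 0], so [inord] does not alter them. *)
Definition window m i w : m.-tuple (Alph (k 0)) := [tuple inord (process w (i + t)) | t < m].

Lemma windowE m i w : (0 < i)%N ->
  [seq nat_of_ord x | x <- window m i w] = [seq process w (i + t) | t <- iota 0 m].
Proof.
move=> i0; rewrite -map_comp -val_enum_ord -map_comp; apply: eq_map => t /=.
rewrite inordK // prednK // process0 ?block_index_lt // addn_gt0 i0 //.
Qed.

Lemma windowP m i w (x : m.-tuple (Alph (k 0))) : (0 < i)%N ->
  (forall t : 'I_m, process w (i + t) = nat_of_ord (tnth x t)) <-> window m i w = x.
Proof.
move=> i0; split=> [h|<- t].
  apply: eq_from_tnth => t; apply: val_inj; rewrite tnth_mktuple /= h.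
  by rewrite inordK.
by rewrite tnth_mktuple inordK // prednK // process0 ?block_index_lt // addn_gt0 i0.
Qed.

Lemma dmeas_window m i : (0 < i)%N -> dmeas (window m i).
Proof.
move=> i0 B.
rewrite (_ : _ @^-1` B = \bigcup_(x in B) [set w | window m i w = x]); last first.
  by apply/seteqP; split=> [w Bw|w [x Bx /= ->]] //; exists (window m i w).
apply: fin_bigcup_measurable => [|x _]; first exact: finite_finset.
rewrite (_ : [set _ | _] =
    [set w | forall t : 'I_m, [set nat_of_ord (tnth x t)] (block_index 0 (i + t) w)]).
  apply: (@dmeas_forall _ _ _ _ (fun (t : 'I_m) w => block_index 0 (i + t) w)
    (fun t => [set nat_of_ord (tnth x t)])) => t.
  exact: dmeas_block_index.
by apply/seteqP; split=> w /=; rewrite -windowP //= => h t; move: (h t);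
  rewrite process0 // addn_gt0 i0.
Qed.

Lemma window_probE m i (x : m.-tuple (Alph (k 0))) : (0 < i)%N ->
  window_prob P S Cc x i = pr [set w | window m i w = x].
Proof.
move=> i0; congr (fine (P _)); apply/seteqP; split=> w /=.
  by move=> h; apply/windowP.
by move=> h; apply/windowP.
Qed.

Lemma sum_window_prob m i (A : pred (m.-tuple (Alph (k 0)))) : (0 < i)%N ->
  \sum_(x | A x) window_prob P S Cc x i = pr [set w | A (window m i w)].
Proof.
move=> i0; have mA : measurable [set w | A (window m i w)].
  exact: (@dmeas_window m i i0 [set x | A x]).
rewrite (prob_split P mA (@dmeas_window m i i0)) [LHS]big_mkcond; apply: eq_bigr => x _.
rewrite window_probE //; case: ifPn => Ax.
  by congr (pr _); apply/seteqP; split=> w /= => [->|[]].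
rewrite (_ : _ `&` _ = set0) ?prob0 //; apply/seteqP; split=> // w /= [+ e].
by rewrite e (negbTE Ax).
Qed.

Lemma window_bound m r n i (A : pred (m.-tuple (Alph (k 0)))) : (0 < i)%N ->
  (2 * 2 ^ (r + n) <= m)%N -> (2 * 4 ^ n <= k r)%N ->
  \sum_(x | A x) window_prob P S Cc x i <=
    2 * (4 ^ n)%:R / (k r)%:R + #|A|%:R * (2 / (k r)%:R ^+ (2 ^ n)).
Proof.
move=> i0 nm hk; rewrite sum_window_prob //.
pose N := (2 ^ (r + n))%N; have N0 : (0 < N)%N by rewrite expn_gt0.
(* [i / N] rounded up: the block starts at most [N - 1] places into the window, hence fits when
   [2 N <= m]. *)
pose a := ((i + N.-1) %/ N)%N.
have [ia aN] : (i <= a * N)%N /\ (a * N <= i + N.-1)%N.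
  split; last by rewrite leq_trunc_div.
  have := divn_eq (i + N.-1) N; have := ltn_pmod (i + N.-1) N0; rewrite -/a; lia.
have a0 : (0 < a)%N by case: (a) ia; rewrite ?mul0n //; case: (i) i0.
(* Cuts the aligned block out of a window, so [A] is traded for at most [#|A|] block words. *)
pose f (x : m.-tuple (Alph (k 0))) : seq nat :=
  take N (drop (a * N - i) [seq nat_of_ord y | y <- x]).
have bl w : f (window m i w) = lev (pairs_at w) 0 (r + n) [:: block_index (r + n) a w].
  have sz : size (f (window m i w)) = N.
    rewrite size_take size_drop size_map size_tuple; rewrite -/N in nm.
    case: ltnP => //; lia.
  apply: (@eq_from_nth _ 0%N); first by rewrite sz size_lev mul1n.
  move=> t; rewrite sz => tN; rewrite -process_block // nth_take // nth_drop windowE //.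
  rewrite -/N in nm; have tm : (a * N - i + t < m)%N by lia.
  rewrite (nth_map 0%N) ?size_iota // nth_iota // add0n; congr (process w _).
  rewrite -/N; lia.
have cA : size [seq f x | x <- enum A] = #|A| by rewrite size_map -cardE.
rewrite -cA; apply: le_trans (block_bound hlaw k_gt0 k_le k_mono
  (dmeas_block_index (r + n) a) _ _ hk _).
- apply: le_prob.
  + exact: (@dmeas_window m i i0 [set x | A x]).
  + have m1 := dmeas_comp (fun j => [:: j]) (dmeas_block_index (r + n) a).
    exact: (dmeas_lev hlaw 0 (r + n) m1 [set y | y \in [seq f x | x <- enum A]]).
  + move=> w Aw /=; rewrite -bl; apply: map_f; rewrite mem_enum.
    exact: Aw.
- by move=> w; apply: block_index_lt.
- by move=> j B; apply: block_index_law.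
Qed.

(** A window of length at most [2^n] lies in two consecutive blocks, hence is given by an offset and
    two indices. Repetitions are harmless: only the length of the list matters. *)
Definition words pr n m := [seq take m (drop o (lev pr 0 n [:: j.1] ++ lev pr 0 n [:: j.2]))
   | o <- iota 0 (2 ^ n), j <- [seq (x, y) | x <- iota 0 (k n), y <- iota 0 (k n)]].

Lemma size_words pr n m : size (words pr n m) = (2 ^ n * k n ^ 2)%N.
Proof. by rewrite /words !size_allpairs !size_iota -mulnn. Qed.

Lemma window_words w n m i : (m <= 2 ^ n)%N -> (2 ^ n <= i)%N ->
  [seq process w (i + t) | t <- iota 0 m] \in words (pairs_at w) n m.
Proof.
move=> mn ni; set N := (2 ^ n)%N in mn ni *; have N0 : (0 < N)%N by rewrite expn_gt0.
have a0 : (0 < i %/ N)%N by rewrite divn_gt0.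
have kk a : (0 < a)%N -> block_index n a w \in iota 0 (k n).
  by move=> a1; rewrite mem_iota block_index_lt.
apply/allpairsP; exists ((i %% N)%N, (block_index n (i %/ N) w, block_index n (i %/ N).+1 w)).
split=> /=.
- by rewrite mem_iota ltn_pmod.
- by apply/allpairsP; exists (block_index n (i %/ N) w, block_index n (i %/ N).+1 w); rewrite !kk.
have sl j : size (lev (pairs_at w) 0 n [:: j]) = N by rewrite size_lev mul1n.
have iE := divn_eq i N; have iN := ltn_pmod i N0.
apply: (@eq_from_nth _ 0%N).
  rewrite size_map size_iota size_take size_drop size_cat !sl.
  case: ltnP; lia.
move=> t; rewrite size_map size_iota => tm.
rewrite (nth_map 0%N) ?size_iota // nth_iota // add0n nth_take // nth_drop nth_cat sl.
case: ltnP => h.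
  rewrite -process_block //; congr (process w _); rewrite -/N; lia.
rewrite -process_block //; last by rewrite -/N; lia.
by congr (process w _); rewrite -/N mulSn; lia.
Qed.

(** Having too many distinct subwords, phrased for a finite word so that Cesaro limits apply; [ts]
    lists where the subwords start. *)
Definition many_words n m T (y : T.-tuple (Alph (k 0))) : Prop :=
  exists ts : seq nat, [/\ all (fun t => t + m <= T)%N ts, (2 ^ n * k n ^ 2 < size ts)%N &
    uniq [seq take m (drop t y) | t <- ts]].

Lemma window_prob_many_words n m T (y : T.-tuple (Alph (k 0))) i :
  (m <= 2 ^ n)%N -> (2 ^ n <= i)%N -> many_words n m y -> window_prob P S Cc y i = 0.
Proof.
move=> mn ni [ts [tsT tsK tsU]].
have i0 : (0 < i)%N by apply: leq_trans ni; rewrite expn_gt0.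
rewrite window_probE // (_ : [set _ | _] = set0) ?prob0 //.
apply/seteqP; split=> // w /= yw.
pose ws := [seq [seq nat_of_ord x | x <- take m (drop t y)] | t <- ts].
have uws : uniq ws.
  rewrite /ws (map_comp (fun s : seq (Alph (k 0)) => [seq nat_of_ord x | x <- s])).
  by rewrite map_inj_uniq //; apply: inj_map; apply: ord_inj.
have sub : {subset ws <= words (pairs_at w) n m}.
  move=> _ /mapP[t tts ->]; have tT : (t + m <= T)%N by move/allP: tsT; apply.
  rewrite map_take map_drop -yw windowE // -map_drop -map_take drop_iota take_iota.
  rewrite (minn_idPl _) ?add0n; last by lia.
  rewrite -[X in iota X]addn0 iotaDl -map_comp.
  rewrite (eq_map (g := fun s => process w (i + t + s))); last by move=> s /=; rewrite addnA.
  by apply: window_words => //; rewrite (leq_trans ni) // leq_addr.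
have := uniq_leq_size uws sub; rewrite size_words size_map leqNgt.
by rewrite tsK.
Qed.

End Windows.

(** * The stationary mean *)

Section Cesaro.
Variable R : realType.
Implicit Types (u : nat -> R) (l b : R).

Definition avg u (N : nat) : R := N%:R^-1 * \sum_(1 <= i < N.+1) u i.

Lemma cvg_invn : (fun N : nat => N%:R^-1 : R) @ \oo --> (0 : R).
Proof. by rewrite -cvg_shiftS; apply: cvg_harmonic. Qed.

Lemma avg_le u l b : (forall i, (0 < i)%N -> u i <= b) -> avg u @ \oo --> l -> l <= b.
Proof.
move=> ub ul; rewrite -(cvg_lim (@Rhausdorff R) ul); apply: limr_le; first exact: cvgP ul.
near=> N; have N0 : (0 < N)%N by near: N; exists 1%N.
rewrite /avg mulrC ler_pdivrMr ?ltr0n //.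
apply: (@le_trans _ _ (\sum_(1 <= i < N.+1) b)).
  by apply: ler_sum_nat => i /andP[i0 _]; apply: ub.
by rewrite sumr_const_nat subn1 /= mulr_natr.
Unshelve. all: by end_near. Qed.

Lemma avg_eventually0 u l i0 : (forall i, (i0 <= i)%N -> u i = 0) ->
  avg u @ \oo --> l -> l = 0.
Proof.
move=> u0 ul; pose c := \sum_(1 <= i < i0.+1) u i.
have h : (fun N : nat => N%:R^-1 * c) @ \oo --> 0 * c.
  by apply: cvgMl; apply: cvg_invn.
rewrite mul0r in h; apply: (cvg_unique (@Rhausdorff R) ul).
apply: cvg_trans h; apply: near_eq_cvg; near=> N.
have N0 : (i0 <= N)%N by near: N; exists i0.
rewrite /avg; congr (_ * _); rewrite (big_cat_nat (n := i0.+1)) //=.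
rewrite [X in _ = _ + X]big1_seq ?addr0 // => i /andP[_].
by rewrite mem_index_iota => /andP[hi _]; apply: u0; apply: ltnW.
Unshelve. all: by end_near. Qed.

(** Shifting by one changes the average by a telescoped difference of size at most [1 / N]. *)
Lemma avg_shift u l t : (forall i, 0 <= u i <= 1) -> avg u @ \oo --> l ->
  avg (fun i => u (i + t)%N) @ \oo --> l.
Proof.
move=> u01 ul; elim: t => [|t IH].
  by rewrite (_ : (fun i => u (i + 0)%N) = u) //; apply/funext => i; rewrite addn0.
set v := fun i => u (i + t)%N in IH.
have v01 i : 0 <= v i <= 1 by apply: u01.
rewrite (_ : (fun i => u (i + t.+1)%N) = fun i => v i.+1); last first.
  by apply/funext => i; rewrite /v addSnnS.
have e N : avg (fun i => v i.+1) N = avg v N + N%:R^-1 * (v N.+1 - v 1%N).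
  rewrite /avg -mulrDr; congr (_ * _).
  have h1 : \sum_(1 <= i < N.+2) v i = v 1%N + \sum_(1 <= i < N.+1) v i.+1.
    by rewrite big_nat_recl.
  have h2 : \sum_(1 <= i < N.+2) v i = \sum_(1 <= i < N.+1) v i + v N.+1.
    by rewrite big_nat_recr.
  lra.
rewrite (_ : avg _ = avg v \+ (fun N : nat => N%:R^-1 * (v N.+1 - v 1%N))); last first.
  exact/funext.
rewrite -[X in _ --> X]addr0; apply: cvgD => //.
have hN : (fun N : nat => - (N%:R^-1 : R)) @ \oo --> (0 : R).
  by rewrite -oppr0; apply: cvgN; apply: cvg_invn.
apply: (squeeze_cvgr _ hN cvg_invn); near=> N.
have := v01 N.+1; have := v01 1%N; have : 0 <= N%:R^-1 :> R by rewrite invr_ge0.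
set x := _^-1; move=> x0 /andP[h1 h2] /andP[h3 h4].
by apply/andP; split; nra.
Unshelve. all: by end_near. Qed.

End Cesaro.

(** * Stationarity, word counts and recurrence under [mu] *)

Section Mean.
Variables (R : realType) (k : nat -> nat).
Variables (d : measure_display) (Om : measurableType d) (P : probability Om R).
Variables (S : forall n, Om -> Sset k n) (Cc : forall n, Om -> 'I_(k n)).
Hypothesis hlaw : RHA_law P S Cc.
Hypothesis k_gt0 : forall n, (0 < k n)%N.
Hypothesis k_le : forall n, (k n.+1 <= k n ^ 2)%N.
Hypothesis k_mono : forall n, (k n <= k n.+1)%N.
Variable mu : probability (Xi (k 0)) R.
Hypothesis hmu : forall m (x : m.-tuple (Alph (k 0))),
  avg (fun i => window_prob P S Cc x i) @ \oo --> fine (mu (cyl x)).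

Local Notation pr := (prob P).
Local Notation prm := (prob mu).

Definition word_at k0 s m (xi : Xi k0) : m.-tuple (Alph k0) := [tuple xi (s + t)%N | t < m].

Lemma word_atP k0 s m (xi : Xi k0) (x : m.-tuple (Alph k0)) :
  (forall t : 'I_m, xi (s + t)%N = tnth x t) <-> word_at s m xi = x.
Proof.
split=> [h|<- t]; last by rewrite tnth_mktuple.
by apply: eq_from_tnth => t; rewrite tnth_mktuple.
Qed.

Lemma cylE k0 m (x : m.-tuple (Alph k0)) : cyl x = [set xi : Xi k0 | word_at 0 m xi = x].
Proof.
by apply/seteqP; split=> xi h; [apply/word_atP|move/word_atP: h].
Qed.

Lemma measurable_cyl k0 m (x : m.-tuple (Alph k0)) : measurable (cyl x : set (Xi k0)).
Proof. by apply: sub_sigma_algebra; exists m, x. Qed.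

(** Cylinders constrain initial segments, so a word at [s] is read off the initial word of length
    [s + m]. *)
Lemma dmeas_word_at k0 s m : dmeas (@word_at k0 s m).
Proof.
have h0 T : dmeas (@word_at k0 0 T).
  move=> B; rewrite (_ : _ @^-1` B = \bigcup_(x in B) (cyl x : set (Xi k0))).
    apply: fin_bigcup_measurable => [|x _]; first exact: finite_finset.
    exact: measurable_cyl.
  apply/seteqP; split=> [xi Bx|xi [x Bx]]; last by rewrite cylE => /= ->.
  by exists (word_at 0 T xi); rewrite ?cylE.
pose f (y : (s + m).-tuple (Alph k0)) : m.-tuple (Alph k0) :=
  [tuple tnth y (rshift s t) | t < m].
have -> : @word_at k0 s m = fun xi => f (word_at 0 (s + m) xi).
  by apply/funext => xi; apply: eq_from_tnth => t; rewrite !tnth_mktuple.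
exact: (dmeas_comp f (h0 (s + m)%N)).
Qed.

Lemma window_prob01 m (x : m.-tuple (Alph (k 0))) i :
  0 <= window_prob P S Cc x i.+1 <= 1.
Proof.
rewrite (window_probE P S Cc k_gt0) // prob_ge0 prob_le1 //.
exact: (@dmeas_window _ _ _ _ _ _ _ hlaw k_gt0 m i.+1 isT [set x]).
Qed.

Lemma mean_sum m (A : pred (m.-tuple (Alph (k 0)))) s :
  prm [set xi | A (word_at s m xi)] = \sum_(x | A x) prm [set xi | word_at s m xi = x].
Proof.
have mw := @dmeas_word_at (k 0) s m.
rewrite (prob_split mu (mw [set x | A x]) mw) [RHS]big_mkcond; apply: eq_bigr => x _.
case: ifPn => Ax.
  by congr (prob _ _); apply/seteqP; split=> xi /= => [[]|->].
rewrite (_ : _ `&` _ = set0) ?prob0 //; apply/seteqP; split=> // xi /= [+ e].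
by rewrite /preimage /= e (negbTE Ax).
Qed.

Lemma mean_lim m (A : pred (m.-tuple (Alph (k 0)))) :
  avg (fun i => \sum_(x | A x) window_prob P S Cc x i) @ \oo -->
  \sum_(x | A x) prm (cyl x).
Proof.
rewrite (_ : avg _ = fun N => \sum_(x | A x) avg (fun i => window_prob P S Cc x i) N).
  by apply: cvg_big => [|x _]; [exact: add_continuous|exact: hmu].
by apply/funext => N; rewrite /avg exchange_big /= mulr_sumr.
Qed.

Lemma mean_stationary m s (x : m.-tuple (Alph (k 0))) :
  prm [set xi | word_at s m xi = x] = prm (cyl x).
Proof.
pose f (y : (s + m).-tuple (Alph (k 0))) : m.-tuple (Alph (k 0)) :=
  [tuple tnth y (rshift s t) | t < m].
pose A y := f y == x.
have -> : [set xi | word_at s m xi = x] = [set xi | A (word_at 0 (s + m) xi)].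
  have e xi : f (word_at 0 (s + m) xi) = word_at s m xi.
    by apply: eq_from_tnth => t; rewrite !tnth_mktuple.
  by apply/seteqP; split=> xi; rewrite /A /= e => /eqP.
rewrite mean_sum; under eq_bigr do rewrite -cylE.
apply: (cvg_unique (@Rhausdorff R) (@mean_lim _ A)).
(* Averages start at position 1; the value 0 at position 0 makes the bounds of [avg_shift] hold at
   every index. *)
have u01 i : 0 <= (fun i => if i is i'.+1 then window_prob P S Cc x i else 0) i <= 1.
  by case: i => [|i]; [rewrite lexx ler01|apply: window_prob01].
have ul : avg (fun i => if i is i'.+1 then window_prob P S Cc x i else 0) @ \oo -->
    prm (cyl x).
  have := @hmu m x; rewrite (_ : avg _ = avg (fun i => if i is i'.+1 then window_prob P S Cc x i else 0)) //.
  apply/funext => N; congr (_ * _); apply: eq_big_nat => i /andP[i0 _].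
  by case: i i0.
have := avg_shift s u01 ul.
rewrite (_ : avg _ = avg (fun i => \sum_(y | A y) window_prob P S Cc y i)) //.
apply/funext => N; congr (_ * _); apply: eq_big_nat => i /andP[i0 _].
rewrite (sum_window_prob hlaw k_gt0) //.
have is0 : (0 < i + s)%N by rewrite addn_gt0 i0.
transitivity (window_prob P S Cc x (i + s)); first by case: (i + s)%N is0.
rewrite (window_probE P S Cc k_gt0) //; congr (pr _).
have e w : f (window S Cc (s + m) i w) = window S Cc m (i + s) w.
  by apply: eq_from_tnth => t; rewrite !tnth_mktuple /= addnA.
by apply/seteqP; split=> w; rewrite /A /= e => /eqP.
Qed.

Lemma mean_event m s (A : pred (m.-tuple (Alph (k 0)))) :
  prm [set xi | A (word_at s m xi)] = prm [set xi | A (word_at 0 m xi)].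
Proof.
rewrite !mean_sum; apply: eq_bigr => x _; by rewrite !mean_stationary.
Qed.

Lemma mean_le m r n (A : pred (m.-tuple (Alph (k 0)))) :
  (2 * 2 ^ (r + n) <= m)%N -> (2 * 4 ^ n <= k r)%N ->
  \sum_(x | A x) prm (cyl x) <=
    2 * (4 ^ n)%:R / (k r)%:R + #|A|%:R * (2 / (k r)%:R ^+ (2 ^ n)).
Proof.
move=> h1 h2; apply: avg_le (@mean_lim m A) => i i0.
exact: (window_bound hlaw k_gt0 k_le k_mono).
Qed.

Lemma take_drop_word_at k0 T t m (xi : Xi k0) : (t + m <= T)%N ->
  take m (drop t (word_at 0 T xi)) = word_at t m xi.
Proof.
move=> tT; have x0 : Alph k0 by exact: ord0.
apply: (@eq_from_nth _ x0).
  by rewrite size_take_min size_drop !size_tuple; lia.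
move=> j; rewrite size_take_min size_drop size_tuple => hj.
have jm : (j < m)%N by lia.
have jT : (t + j < T)%N by lia.
rewrite nth_take // nth_drop.
have := tnth_nth x0 (word_at 0 T xi) (Ordinal jT); rewrite tnth_mktuple /= => <-.
by have := tnth_nth x0 (word_at t m xi) (Ordinal jm); rewrite tnth_mktuple /= => <-.
Qed.

Definition few_words k0 m K : set (Xi k0) :=
  [set xi | (#|[pred x : m.-tuple (Alph k0) | `[< exists s, word_at s m xi = x >]]| <= K)%N].

(** Too many words already show in some initial segment. Windows from position [2^n] on never equal
    such a segment, so its Cesaro mean is 0, and countably many lengths [T] suffice. *)
Lemma ae_few_words n m : (m <= 2 ^ n)%N -> mu.-negligible (~` few_words m (2 ^ n * k n ^ 2)).
Proof.
move=> mn; pose M T := [pred y : T.-tuple (Alph (k 0)) | `[< many_words n m y >]].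
have M0 T : prm [set xi | M T (word_at 0 T xi)] = 0.
  rewrite mean_sum big1 // => y /asboolP My; rewrite -cylE.
  apply: (avg_eventually0 (i0 := (2 ^ n)%N) _ (@hmu T y)) => i hi.
  exact: (window_prob_many_words P S Cc k_gt0 mn hi My).
apply: (@negligibleS _ _ _ _ (\bigcup_T [set xi | M T (word_at 0 T xi)])); last first.
  apply: negligible_bigcup => T; have mT := @dmeas_word_at (k 0) 0 T [set y | M T y].
  apply/negligibleP; first exact: mT.
  by apply: etrans (esym (probK mu mT)) _; congr (_%:E); exact: M0.
move=> xi; rewrite /few_words /= => /negP; rewrite -ltnNge.
set D := [pred x | _] => hD.
have /choice[f hf] : forall x : m.-tuple (Alph (k 0)), exists s, D x -> word_at s m xi = x.
  move=> x; have [/asboolP[s hs]|] := boolP (D x); first by exists s.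
  by move=> _; exists 0%N.
pose ts := [seq f x | x <- enum D]; pose T := (\max_(t <- ts) t + m)%N.
exists T => //=; apply/asboolP; exists ts; split.
- apply/allP => t tts; rewrite leq_add2r.
  exact: (@leq_bigmax_seq _ ts xpredT id).
- by rewrite size_map -cardE.
have tE t : t \in ts -> take m (drop t (word_at 0 T xi)) = word_at t m xi.
  by move=> tts; apply: take_drop_word_at; rewrite leq_add2r (@leq_bigmax_seq _ ts xpredT id).
rewrite (eq_in_map _ (fun t => tval (word_at t m xi)) ts).1; last by move=> t; apply: tE.
rewrite /ts -map_comp (eq_in_map _ (fun x => tval x) (enum D)).1.
  by rewrite map_inj_uniq ?enum_uniq //; apply: val_inj.
by move=> x; rewrite mem_enum => Dx; exact: (congr1 val (hf x Dx)).
Qed.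

(* The [N.+1] translates of "[x] occurs at [s] but not at the next [N] positions"
   are disjoint and have equal measure. *)
Lemma last_occurrence0 m (x : m.-tuple (Alph (k 0))) s :
  mu.-negligible [set xi | word_at s m xi = x /\ forall t, (s < t)%N -> word_at t m xi <> x].
Proof.
pose E N s : set (Xi (k 0)) :=
  [set xi | word_at s m xi = x /\ forall t : 'I_N, word_at (s + t.+1) m xi <> x].
have mE N t : measurable (E N t).
  apply: measurableI; first exact: (@dmeas_word_at (k 0) t m [set x]).
  by apply: (@dmeas_forall _ _ _ _ (fun (u : 'I_N) xi => word_at (t + u.+1) m xi)
    (fun=> ~` [set x])) => u; apply: dmeas_word_at.
(* [E N t] depends only on the word of length [N + m] at [t], so stationarity applies. *)
have EE N t : prm (E N t) = prm (E N 0).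
  pose g (j : nat) (y : (N + m).-tuple (Alph (k 0))) :=
    [seq nth ord0 y (j + u) | u <- iota 0 m].
  pose A (y : (N + m).-tuple (Alph (k 0))) :=
    (g 0%N y == x) && [forall u : 'I_N, g u.+1 y != x].
  have gE j xi t' : (j <= N)%N -> (g j (word_at t' (N + m) xi) == x) = (word_at (t' + j) m xi == x).
    move=> jN; rewrite -[RHS]val_eqE; congr (_ == _).
    apply: (@eq_from_nth _ ord0); first by rewrite size_map size_iota size_tuple.
    move=> u; rewrite size_map size_iota => um.
    rewrite (nth_map 0%N) ?size_iota // nth_iota // add0n.
    have jum : (j + u < N + m)%N by lia.
    have := tnth_nth ord0 (word_at t' (N + m) xi) (Ordinal jum).
    rewrite tnth_mktuple /= => <-.
    have := tnth_nth ord0 (word_at (t' + j) m xi) (Ordinal um).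
    by rewrite tnth_mktuple /= => <-; rewrite addnA.
  have EA t' : E N t' = [set xi | A (word_at t' (N + m) xi)].
    apply/seteqP; split=> xi; rewrite /E /A /=.
      move=> [h1 h2]; rewrite gE // addn0 h1 eqxx /=; apply/forallP => u.
      by rewrite gE //; apply/eqP.
    rewrite gE // addn0 => /andP[/eqP h1 /forallP h2]; split=> // u.
    by have := h2 u; rewrite gE // => /eqP.
  by rewrite !EA mean_event.
have bound N : N.+1%:R * prm (E N 0) <= 1.
  have tr : trivIset setT (fun j : 'I_N.+1 => E N j).
    move=> i j _ _ [xi [[hi1 hi2] [hj1 hj2]]]; apply: ord_inj; apply/eqP.
    case: ltngtP => // ij.
      have uN : (j - i.+1 < N)%N by have := ltn_ord j; lia.
      by have := hi2 (Ordinal uN); rewrite /= subnSK // subnKC // ltnW.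
    have uN : (i - j.+1 < N)%N by have := ltn_ord i; lia.
    by have := hj2 (Ordinal uN); rewrite /= subnSK // subnKC // ltnW.
  have h := @measure_bigsetU_ord _ _ _ mu N.+1 xpredT (fun j => E N j) (fun j => mE N j) tr.
  have mU : measurable (\big[setU/set0]_(j < N.+1) E N j) by apply: bigsetU_measurable.
  rewrite -lee_fin; apply: le_trans (probability_le1 mu mU).
  rewrite h (eq_bigr (fun=> (prm (E N 0))%:E)); last by move=> j _; rewrite -(EE N j) probK.
  by rewrite sumEFin sumr_const card_ord mulr_natl.
have mL : measurable [set xi | word_at s m xi = x /\ forall t, (s < t)%N -> word_at t m xi <> x].
  rewrite (_ : [set _ | _] = \bigcap_N E N s).
    by apply: bigcapT_measurable.
  apply/seteqP; split=> xi.
    by move=> [h1 h2] N _; split=> // t; apply: h2; rewrite -addSnnS leq_addr.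
  move=> h; split; first by have [] := h 0%N I.
  move=> t st; have [_ h2] := h t I.
  have ut : (t - s.+1 < t)%N by lia.
  by have := h2 (Ordinal ut); rewrite /= -addSnnS subnKC.
apply/negligibleP; first exact: mL.
apply: etrans (esym (probK mu mL)) _; congr (_%:E); apply/eqP.
rewrite eq_le prob_ge0 andbT; set q := prm _.
have qN N : N.+1%:R * q <= 1.
  apply: le_trans (bound N); rewrite -(EE N s) ler_wpM2l //.
  apply: le_prob => // xi [h1 h2]; split=> // t; apply: h2.
  by rewrite -addSnnS leq_addr.
rewrite leNgt; apply/negP => q0.
have := qN (Num.truncn q^-1); have := truncnS_gt q^-1.
rewrite -(ltr_pM2r q0) mulVf ?gt_eqF // => h1 h2.
by have := lt_le_trans h1 h2; rewrite ltxx.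
Qed.

End Mean.

(** * The random ergodic measure *)

(** Gibbs' inequality against weight [1 / K] on the support: the corrections [1 / K - p x] sum to at
    most 0 there, as the support has at most [K] points. *)
Lemma entropy_le_ln_card (R : realType) (T : finType) (p : T -> R) (K : nat) :
  (forall x, 0 <= p x) -> \sum_x p x = 1 -> (#|[pred x | p x != 0%R]| <= K)%N ->
  \sum_x - xlnx (p x) <= ln K%:R.
Proof.
move=> p0 p1 pK.
have K0 : (0 < K)%N.
  case: (posnP K) pK => // ->; rewrite leqn0 => /eqP /card0_eq h.
  have : \sum_x p x = 0 by apply: big1 => x _; have := h x; rewrite inE => /negbFE /eqP.
  by rewrite p1 => /eqP; rewrite oner_eq0.
have K0' : 0 < K%:R :> R by rewrite ltr0n.
have term x : - xlnx (p x) <= p x * ln K%:R + (if p x != 0 then K%:R^-1 - p x else 0).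
  rewrite /xlnx; have [->|px] := eqVneq (p x) 0.
    by rewrite mul0r oppr0 addr0.
  have px0 : 0 < p x by rewrite lt_def px p0.
  have pK0 : 0 < p x * K%:R by rewrite mulr_gt0.
  (* Gibbs: [ln y <= y - 1] at [y = 1 / (p K)] *)
  have h : ln (p x * K%:R)^-1 <= (p x * K%:R)^-1 - 1.
    have := @le_ln1Dx R ((p x * K%:R)^-1 - 1).
    by rewrite [1 + _]addrC subrK; apply; rewrite ltrBrDr addNr invr_gt0.
  rewrite lnV ?posrE // lnM ?posrE // in h.
  have e : p x * (p x * K%:R)^-1 = K%:R^-1 by field; rewrite px gt_eqF.
  have := ler_wpM2l (ltW px0) h; rewrite /= mulrBr e; lra.
apply: le_trans (ler_sum _ (fun x _ => term x)) _.
rewrite big_split /= -mulr_suml p1 mul1r gerDl -big_mkcond sumrB subr_le0.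
rewrite sumr_const -[_^-1 *+ _]mulr_natl.
have -> : \sum_(x | p x != 0) p x = 1.
  by rewrite -p1 [RHS](bigID (fun x => p x != 0)) /= [X in _ + X]big1 ?addr0 // => x /negbNE /eqP.
by rewrite ler_pdivrMr // mul1r ler_nat.
Qed.

Lemma xlnx_le0 (R : realType) (p : R) : 0 <= p <= 1 -> 0 <= - xlnx p.
Proof.
move=> /andP[p0 p1]; rewrite /xlnx; case: eqP => _; rewrite ?oppr0 //.
by rewrite oppr_ge0 mulr_ge0_le0 // ln_le0.
Qed.

Section Ergodic.
Variables (R : realType) (k0 : nat).
Variable mu : probability (Xi k0) R.
Variable F : Xi k0 -> probability (Xi k0) R.
Hypothesis hF : is_reg_cond_prob_inv mu F.
Hypothesis hlast : forall m (x : m.-tuple (Alph k0)) s,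
  mu.-negligible [set xi | word_at s m xi = x /\ forall t, (s < t)%N -> word_at t m xi <> x].

Local Notation prm := (prob mu).

Lemma measurable_F B : measurable B -> measurable_fun setT (fun xi => F xi B).
Proof.
move=> mB _ Y mY; rewrite setTI; have [h _] := hF mB.
by have [] := h Y mY.
Qed.

Lemma Fcyl_ge0 xi m (x : m.-tuple (Alph k0)) : 0 <= Fcyl F xi x.
Proof. exact: prob_ge0. Qed.

Lemma sum_Fcyl xi m : \sum_(x : m.-tuple (Alph k0)) Fcyl F xi x = 1.
Proof.
rewrite -(probT (F xi)) (prob_split (F xi) (@measurableT _ (Xi k0)) (@dmeas_word_at k0 0 m)).
by apply: eq_bigr => x _; rewrite /Fcyl cylE setTI.
Qed.

Lemma Fcyl_le1 xi m (x : m.-tuple (Alph k0)) : Fcyl F xi x <= 1.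
Proof. by apply: prob_le1; apply: measurable_cyl. Qed.

Lemma measurable_Fcyl m (x : m.-tuple (Alph k0)) :
  measurable_fun setT (fun xi => Fcyl F xi x).
Proof.
have h := measurable_F (measurable_cyl x).
by apply: measurableT_comp h.
Qed.

(* The set of sequences in which [x] occurs finitely often is invariant and,
   by Poincare recurrence, meets [cyl x] in a null set. *)
Lemma ae_occurs m (x : m.-tuple (Alph k0)) :
  \forall xi \ae mu, Fcyl F xi x != 0 -> exists s, word_at s m xi = x.
Proof.
pose A : set (Xi k0) := [set xi | exists s, forall t, (s <= t)%N -> word_at t m xi <> x].
have mw t : measurable [set xi : Xi k0 | word_at t m xi <> x].
  exact: (@dmeas_word_at k0 t m [set y | y <> x]).
have mA : measurable A.
  rewrite (_ : A = \bigcup_s \bigcap_t [set xi | (s <= t)%N -> word_at t m xi <> x]).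
    apply: bigcupT_measurable => s; apply: bigcapT_measurable => t.
    have [st|st] := leqP s t; last first.
      by rewrite (_ : [set _ | _] = setT) //; apply/seteqP; split.
    rewrite (_ : [set _ | _] = [set xi | word_at t m xi <> x]) //.
    by apply/seteqP; split=> xi /=; auto.
  apply/seteqP; split=> xi; first by move=> [s h]; exists s => // t _; exact: h.
  by move=> [s _ h]; exists s => t st; exact: (h t I st).
have shiftE t xi : word_at t m (Defs.shift k0 xi) = word_at t.+1 m xi.
  by apply: eq_from_tnth => u; rewrite !tnth_mktuple.
have iA : invariant_sets k0 A.
  split=> //; apply/seteqP; split=> xi [s h].
    by exists s.+1 => -[|t] // st; rewrite -shiftE; apply: h.
  by exists s => t st; rewrite shiftE; apply: h; rewrite leqW.
have A0 : mu (A `&` cyl x) = 0.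
  apply/negligibleP; first by apply: measurableI => //; apply: measurable_cyl.
  apply: (@negligibleS _ _ _ _ (\bigcup_s [set xi | word_at s m xi = x /\
    forall t, (s < t)%N -> word_at t m xi <> x])); last first.
    by apply: negligible_bigcup => s; apply: hlast.
  move=> xi [[s h]]; rewrite cylE => /= x0.
  (* The least [s] after which [x] never occurs is positive, since [x] occurs at 0; its predecessor
     is the last occurrence. *)
  have ex : exists s, `[< forall t, (s <= t)%N -> word_at t m xi <> x >].
    by exists s; apply/asboolP.
  have [s0 /asboolP hs0 hmin] := ex_minnP ex.
  case: s0 hs0 hmin => [|s0] hs0 hmin; first by case: (hs0 0%N isT).
  exists s0 => //; split; last exact: hs0.
  apply: contrapT => hs; have : (s0 < s0)%N; last by rewrite ltnn.
  apply: hmin; apply/asboolP => t; rewrite leq_eqVlt => /orP[/eqP <- //|].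
  exact: hs0.
have mF := measurable_F (measurable_cyl x).
have int0 : (\int[mu]_(xi in A) `|F xi (cyl x)| = 0)%E.
  rewrite (eq_integral (fun xi => F xi (cyl x))).
    by rewrite (proj2 (hF (measurable_cyl x)) A iA) A0.
  by move=> xi _; rewrite gee0_abs.
have /(ae_eq_integral_abs _ mA) h := int0.
have {}h := h (measurable_funTS mF).
apply: filterS h => xi h Fx.
(* If [x] never occurs then [xi] lies in [A], with [s = 0], where [F] vanishes on the cylinder. *)
apply: contrapT => hne; move/eqP: Fx; apply; rewrite /Fcyl h //.
by exists 0%N => t _ tx; apply: hne; exists t.
Qed.

Lemma ae_support m K : mu.-negligible (~` few_words m K) ->
  \forall xi \ae mu, (#|[pred x : m.-tuple (Alph k0) | Fcyl F xi x != 0%R]| <= K)%N.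
Proof.
move=> hK.
have h1 : \forall xi \ae mu, few_words m K xi by [].
have h2 : \forall xi \ae mu, forall x : m.-tuple (Alph k0),
    Fcyl F xi x != 0 -> exists s, word_at s m xi = x.
  by apply: filter_forall => x; apply: ae_occurs.
apply: filterS2 h1 h2 => xi h1 h2; apply: leq_trans h1; apply: subset_leq_card.
by apply/fintype.subsetP => x hx; exact: (asboolT (h2 x hx)).
Qed.

Variable C : forall m, m.-tuple (Alph k0) -> seq bool.

Lemma H_F_ge0 m xi : 0 <= H_F F m xi.
Proof. by apply: sumr_ge0 => x _; apply: xlnx_le0; rewrite Fcyl_ge0 Fcyl_le1. Qed.

Lemma EF_len_ge0 m xi : 0 <= EF_len F C m xi.
Proof. by apply: sumr_ge0 => x _; rewrite mulr_ge0 ?Fcyl_ge0. Qed.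

Lemma measurable_EF_len m : measurable_fun setT (EF_len F C m).
Proof.
apply: measurable_sum => x; apply: measurable_funM => //; exact: measurable_Fcyl.
Qed.

Lemma measurable_H_F m : measurable_fun setT (H_F F m).
Proof.
apply: measurable_sum => x; apply: measurable_funN.
rewrite (_ : (fun _ => _) = fun xi => Fcyl F xi x * ln (Fcyl F xi x)).
  apply: measurable_funM; first exact: measurable_Fcyl.
  by apply: measurableT_comp (measurable_Fcyl x); apply: measurable_ln.
by apply/funext => xi; rewrite /xlnx; case: eqP => // ->; rewrite mul0r.
Qed.

Lemma measurable_code_ratio m : measurable_fun setT (code_ratio F C m).
Proof.
apply: measurable_fun_ifT => //.
  by apply: measurable_fun_eqr => //; apply: measurable_H_F.
apply/measurable_EFinP; apply: measurable_funM; first exact: measurable_EF_len.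
(* The inverse as a power of exponent -1; the two agree at 0 as well. *)
rewrite (_ : (fun _ => _) = fun xi => powR (H_F F m xi) (-1)).
  exact: (measurableT_comp (@measurable_powR R (-1)) (measurable_H_F m)).
by apply/funext => xi; rewrite powR_inv1 // H_F_ge0.
Qed.

(** Tower property: the identity defining [F], on the whole space, for each cylinder. *)
Lemma integral_EF_len m :
  (\int[mu]_xi (EF_len F C m xi)%:E =
    (\sum_(x : m.-tuple (Alph k0)) prm (cyl x) * (size (C x))%:R)%:E)%E.
Proof.
have e xi : (EF_len F C m xi)%:E =
    (\sum_(x : m.-tuple (Alph k0)) (size (C x))%:R%:E * F xi (cyl x))%E.
  rewrite /EF_len -sumEFin; apply: eq_bigr => x _.
  by rewrite EFinM muleC /Fcyl -/(prob (F xi) _) probK //; apply: measurable_cyl.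
under eq_integral do rewrite e.
have mF x : measurable_fun setT (fun xi => F xi (cyl (x : m.-tuple (Alph k0)))).
  by apply: measurable_F; apply: measurable_cyl.
rewrite ge0_integral_sum //; last 2 first.
- by move=> x; apply: emeasurable_funM.
- by move=> x xi _; rewrite mule_ge0.
rewrite -sumEFin; apply: eq_bigr => x _; rewrite ge0_integralZl //.
have iT : invariant_sets k0 setT by split.
rewrite (proj2 (hF (measurable_cyl x)) setT iT) setTI EFinM muleC; congr (_ * _)%E.
by rewrite probK //; apply: measurable_cyl.
Qed.

(** Almost surely [H_F] is at most [ln K], which is positive; where [H_F] is 0 the ratio is infinite
    and the bound is trivial. *)
Lemma integral_code_ratio_ge m K : (1 < K)%N -> mu.-negligible (~` few_words m K) ->
  (((\sum_(x : m.-tuple (Alph k0)) prm (cyl x) * (size (C x))%:R) / ln K%:R)%:E <=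
    \int[mu]_xi code_ratio F C m xi)%E.
Proof.
move=> K1 hK; have lK : 0 < ln K%:R :> R by rewrite ln_gt0 // ltr1n.
rewrite mulrC EFinM -integral_EF_len -ge0_integralZl //; last 3 first.
- by apply/measurable_EFinP; apply: measurable_EF_len.
- by move=> xi _; rewrite lee_fin EF_len_ge0.
- by rewrite lee_fin invr_ge0 ltW.
apply: ae_ge0_le_integral => //.
- by move=> xi _; rewrite -EFinM lee_fin mulr_ge0 ?EF_len_ge0 // invr_ge0 ltW.
- apply: emeasurable_funM => //; apply/measurable_EFinP; exact: measurable_EF_len.
- move=> xi _; rewrite /code_ratio; case: ifP => // _.
  by rewrite lee_fin divr_ge0 ?EF_len_ge0 ?H_F_ge0.
- exact: measurable_code_ratio.
apply: filterS (ae_support hK) => xi hxi _.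
rewrite /code_ratio; case: ifPn => [_|H0]; first by rewrite leey.
rewrite -EFinM lee_fin mulrC ler_wpM2l ?EF_len_ge0 //.
have Hp : 0 < H_F F m xi by rewrite lt_def H0 H_F_ge0.
rewrite lef_pV2 ?posrE //; apply: entropy_le_ln_card => //.
- by move=> x; apply: Fcyl_ge0.
- exact: sum_Fcyl.
Qed.

End Ergodic.

(** * Counting codewords and growth estimates *)

(* The leading 1 makes words of different lengths distinguishable. *)
Definition bits_code (s : seq bool) : nat := foldr (fun (b : bool) a => (b + a.*2)%N) 1%N s.

Lemma bits_code_gt0 s : (0 < bits_code s)%N.
Proof. by elim: s => //= b s IH; rewrite addn_gt0 double_gt0 IH orbT. Qed.

Lemma bits_code_inj : injective bits_code.
Proof.
elim=> [|b s IH] [|b' s'] //=.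
- by have := bits_code_gt0 s'; lia.
- by have := bits_code_gt0 s; lia.
- move=> e; have bb : b = b' by move: (congr1 odd e); rewrite !oddD !odd_double !addbF; case: (b); case: (b').
  by rewrite bb in e *; congr (_ :: _); apply: IH; apply: double_inj; apply: addnI e.
Qed.

Lemma bits_code_lt s : (bits_code s < 2 ^ (size s).+1)%N.
Proof. by elim: s => //= b s IH; rewrite expnS; case: b => /=; lia. Qed.

Lemma card_short_codes (T : finType) (C : T -> seq bool) L : injective C ->
  (#|[pred x | (size (C x) < L)%N]| <= 2 ^ L)%N.
Proof.
move=> injC; rewrite cardE -(size_map (fun x => bits_code (C x))) -[X in (_ <= X)%N](size_iota 0).
apply: uniq_leq_size.
  by rewrite map_inj_uniq ?enum_uniq // => x y /bits_code_inj /injC.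
move=> _ /mapP[x + ->]; rewrite mem_enum inE mem_iota /= add0n => h.
by apply: leq_trans (bits_code_lt _) _; rewrite leq_exp2l.
Qed.

(** Markov: at least half of the mass sits on codewords of length at least [L]. *)
Lemma mean_length_ge (R : realType) (T : finType) (p : T -> R) (C : T -> seq bool) L :
  (forall x, 0 <= p x) -> \sum_x p x = 1 ->
  \sum_(x | (size (C x) < L)%N) p x <= 2^-1 ->
  L%:R / 2 <= \sum_x p x * (size (C x))%:R.
Proof.
move=> p0 p1 hL; rewrite (bigID (fun x => (size (C x) < L)%N)) /=.
have h1 : \sum_(x | ~~ (size (C x) < L)%N) p x * L%:R <=
    \sum_(x | ~~ (size (C x) < L)%N) p x * (size (C x))%:R.
  by apply: ler_sum => x; rewrite -leqNgt => h; rewrite ler_wpM2l // ler_nat.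
have h2 : 0 <= \sum_(x | (size (C x) < L)%N) p x * (size (C x))%:R.
  by apply: sumr_ge0 => x _; rewrite mulr_ge0.
have h3 : 2^-1 <= \sum_(x | ~~ (size (C x) < L)%N) p x.
  by move: p1; rewrite (bigID (fun x => (size (C x) < L)%N)) /=; lra.
rewrite -mulr_suml in h1; have := ler_wpM2r (ler0n R L) h3; lra.
Qed.

Lemma ln2_ge (R : realType) : 2^-1 <= ln 2 :> R.
Proof.
have := @le_ln1Dx R (- 2^-1).
rewrite (_ : 1 - 2^-1 = 2^-1); last by lra.
by rewrite lnV ?posrE // => h; have := h ltac:(lra); lra.
Qed.

Lemma ln2_le1 (R : realType) : ln 2 <= 1 :> R.
Proof. by have := @le_ln1Dx R 1; rewrite -[1 + 1]/2 => h; apply: h; lra. Qed.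

(** * Growth of the perplexities and choice of the level *)

Section Growth.
Variables (R : realType) (beta : R).
Hypothesis beta0 : 0 < beta.
Hypothesis beta1 : beta < 1.

Local Notation k := (kRHA beta).
Let y (n : nat) : R := powR 2 (beta * n%:R).

Lemma y_ge1 n : 1 <= y n.
Proof.
by rewrite /y -[leLHS](powRr0 2) ler_powR ?ler1n // mulr_ge0 ?ler0n // ltW.
Qed.

Lemma k_bounds n : (k n)%:R <= expR (y n) /\ expR (y n) < (k n).+1%:R.
Proof.
have /andP[h1 h2] := truncn_itv (expR_ge0 (y n)).
by split.
Qed.

Lemma k_ge2 n : (2 <= k n)%N.
Proof.
have [_ h] := k_bounds n; rewrite -ltnS -(ltr_nat R); apply: le_lt_trans h.
by apply: le_trans (expR_ge1Dx _); have := y_ge1 n; lra.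
Qed.

Lemma k_ge n : expR (y n) / 2 <= (k n)%:R.
Proof.
have [_ h] := k_bounds n; have := k_ge2 n; rewrite -(ler_nat R) => h2.
by rewrite -natr1 in h; lra.
Qed.

Lemma lnk_le n : ln (k n)%:R <= y n.
Proof.
have [h _] := k_bounds n; rewrite -[leRHS]expRK ler_ln ?posrE ?expR_gt0 //.
by rewrite ltr0n (leq_trans _ (k_ge2 n)).
Qed.

Lemma lnk_ge n : y n / 2 <= ln (k n)%:R.
Proof.
have k0 : 0 < (k n)%:R :> R by rewrite ltr0n (leq_trans _ (k_ge2 n)).
have h1 : ln 2 <= ln (k n)%:R :> R.
  by rewrite ler_ln ?posrE // (ler_nat R 2) k_ge2.
have : ln (expR (y n) / 2) <= ln (k n)%:R.
  by rewrite ler_ln ?posrE ?k_ge // divr_gt0 // expR_gt0.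
by rewrite lnM ?posrE ?expR_gt0 ?invr_gt0 // lnV ?posrE // expRK; lra.
Qed.

Lemma y_natX n : y n = powR (2 ^+ n) beta.
Proof. by rewrite /y mulrC powRrM powR_mulrn. Qed.

(** The offset term [n * ln 2] is absorbed by [y n], since [exp t >= 1 + t] at
    [t = beta * n * ln 2]. *)
Lemma ln_supp_le n : ln ((2 ^ n * k n ^ 2)%:R : R) <= ((beta * ln 2)^-1 + 2) * y n.
Proof.
have k0 : 0 < (k n)%:R :> R by rewrite ltr0n (leq_trans _ (k_ge2 n)).
rewrite natrM !natrX lnM ?posrE ?exprn_gt0 // !lnXn // mulrDl; apply: lerD; last first.
  by rewrite mulr2n; have := lnk_le n; lra.
have l2 := ln2_ge R; have b2 : 0 < beta * ln 2 by rewrite mulr_gt0 //; lra.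
have h : n%:R * (beta * ln 2) <= y n.
  rewrite /y /powR gt_eqF //; apply: le_trans (expR_ge1Dx _).
  by rewrite mulrCA mulrA; lra.
rewrite -ler_pdivlMr // in h; rewrite mulrC; apply: le_trans h.
by rewrite -[ln 2 *+ n]mulr_natl ler_piMr ?ler0n ?ln2_le1.
Qed.

(** [t] solves [2^(beta t) = z] and [r] is the next integer; overshooting by at most one level costs
    the factor 2. *)
Lemma level_exists (z : R) : 1 <= z ->
  exists r : nat, [/\ z <= y r, 2 ^+ r <= 2 * powR z beta^-1 &
    r%:R <= ln z / (beta * ln 2) + 1].
Proof.
move=> z1; have l2 := ln2_ge R; have b2 : 0 < beta * ln 2 by rewrite mulr_gt0 //; lra.
have z0 : 0 < z by lra.
set t := ln z / (beta * ln 2); have t0 : 0 <= t by rewrite divr_ge0 ?ln_ge0 // ltW.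
have /andP[h1 h2] := truncn_itv t0; exists (Num.truncn t).+1; split.
- rewrite /y /powR gt_eqF // -[leLHS]lnK ?posrE // ler_expR.
  by rewrite mulrAC -ler_pdivrMl // mulrC ltW.
- rewrite exprS ler_pM2l // -powR_mulrn // /powR !gt_eqF // ler_expR.
  apply: (@le_trans _ _ (t * ln 2)); first by rewrite ler_wpM2r //; lra.
  rewrite /t le_eqVlt; apply/orP; left; apply/eqP; field.
  by rewrite !gt_eqF //; lra.
- by rewrite -natr1 lerD2r.
Qed.

Lemma ln_affine_small (c : R) : 0 < c ->
  exists N : nat, forall n : nat, (N <= n)%N -> ln (2 * n%:R + 4) / c + 1 <= n%:R :> R.
Proof.
move=> c0; pose a : R := 2 * c - 1 - ln (c / 4).
exists (Num.truncn (`|a| * 2 / c)).+1 => n hn.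
have an : `|a| * 2 / c < n%:R.
  by apply: lt_le_trans (truncnS_gt _) _; rewrite ler_nat.
rewrite ltr_pdivrMr // in an.
have z0 : 0 < 2 * n%:R + 4 :> R by have := ler0n R n; lra.
have e0 : 0 < c / 4 by rewrite divr_gt0.
have := @le_ln1Dx R (c / 4 * (2 * n%:R + 4) - 1).
rewrite [1 + _]addrC subrK lnM ?posrE // => h.
have {}h := h ltac:(have := mulr_gt0 e0 z0; lra).
rewrite -lerBrDr ler_pdivrMr //; have := ler_norm a; rewrite /a; lra.
Qed.

Lemma growth_bound n r m : (r <= n)%N -> (2 ^ n.+1 <= m < 2 ^ n.+2)%N ->
  2 ^+ r <= 2 * powR (2 * n%:R + 4) beta^-1 ->
  powR m%:R (1 - beta) / powR (ln m%:R) (beta^-1 - 1) <=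
  4 * 2 * powR 8 (beta^-1 - 1) * (2 ^+ (n - r) * y r / y n.+2).
Proof.
move=> rn /andP[m1 m2] hr.
have m0 : (0 < m)%N by apply: leq_trans m1; rewrite expn_gt0.
have mR : 0 < m%:R :> R by rewrite ltr0n.
have l2 := ln2_ge R.
set e := beta^-1 - 1; have e0 : 0 < e by rewrite subr_gt0 invf_gt1.
set z : R := 2 * n%:R + 4 in hr.
have n0 : 0 <= n%:R :> R by rewrite ler0n.
have lnm : z <= 8 * ln m%:R.
  have : ln ((2 : R) ^+ n.+1) <= ln m%:R.
    by rewrite ler_ln ?posrE ?exprn_gt0 // -natrX ler_nat.
  rewrite lnXn // -[ln 2 *+ _]mulr_natl -natr1 => h.
  have : 2^-1 * (n%:R + 1) <= (n%:R + 1) * ln 2 :> R by nra.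
  by rewrite /z; lra.
have lm0 : 0 < ln m%:R :> R by rewrite /z in lnm; lra.
set Lm := powR (ln m%:R) e; have Lm0 : 0 < Lm by rewrite powR_gt0.
have z0 : 0 < z by rewrite /z; lra.
have two_r0 : 0 < (2 : R) ^+ r by rewrite exprn_gt0.
set w := powR ((2 : R) ^+ r) (1 - beta).
have w0 : 0 < w by rewrite powR_gt0.
have wle : w <= powR 2 (1 - beta) * (powR 8 e * Lm).
  rewrite /Lm -powRM //; last exact: ltW.
  apply: (@le_trans _ _ (powR (2 * powR z beta^-1) (1 - beta))).
    by rewrite ge0_ler_powR ?nnegrE ?(ltW two_r0) ?mulr_ge0 ?powR_ge0 ?subr_ge0 ?(ltW beta1).
  rewrite powRM ?powR_ge0 // ler_wpM2l ?powR_ge0 // -powRrM.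
  have -> : beta^-1 * (1 - beta) = e by rewrite /e mulrBr mulr1 mulVf ?gt_eqF.
  by rewrite ge0_ler_powR ?nnegrE ?(ltW z0) ?(ltW e0) ?mulr_ge0 ?(ltW lm0).
have yr : y r = 2 ^+ r / w.
  rewrite y_natX /w -[X in X / _]powRr1 ?(ltW two_r0) // -powRB ?subKr //.
  by rewrite (gt_eqF two_r0) implybT.
have q2 : 2 ^+ n = 2 ^+ (n - r) * 2 ^+ r :> R by rewrite -exprD subnK.
have -> : 2 ^+ (n - r) * y r / y n.+2 = 2 ^+ n / w / y n.+2.
  by rewrite yr q2 !mulrA.
set mb := powR m%:R beta; have mb0 : 0 < mb by rewrite powR_gt0.
have mE : m%:R = powR m%:R (1 - beta) * mb.
  by rewrite /mb -powRD ?(gt_eqF mR) ?implybT // subrK powRr1.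
set M := powR m%:R (1 - beta) in mE *.
have M0 : 0 < M by rewrite powR_gt0.
have yn : y n.+2 <= powR 2 beta * mb.
  rewrite y_natX /mb -powRM ?(ltW mR) // ge0_ler_powR ?nnegrE ?(ltW beta0) ?exprn_ge0 //.
  by rewrite exprS ler_pM2l // -natrX ler_nat.
have y0 : 0 < y n.+2 by apply: lt_le_trans (y_ge1 _).
have m4 : m%:R <= 4 * 2 ^+ n :> R.
  have : m%:R <= (2 ^ n.+2)%:R :> R by rewrite ler_nat ltnW.
  by rewrite natrX !exprS; lra.
set p1 := powR 2 (1 - beta) in wle; set p2 := powR 2 beta in yn.
have p12 : p1 * p2 = 2 by rewrite /p1 /p2 -powRD ?implybT ?subrK ?powRr1 // pnatr_eq0 implybT.
have p10 : 0 < p1 by rewrite powR_gt0.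
set g := powR 8 e in wle *; have g0 : 0 < g by rewrite powR_gt0.
rewrite ler_pdivrMr // (_ : _ * Lm = 4 * 2 ^+ n * (p1 * (g * Lm) * (p2 * mb)) / (w * y n.+2) / mb).
  rewrite ler_pdivlMr // -mE ler_pdivlMr; last exact: mulr_gt0.
  apply: ler_pM => //; first by rewrite mulr_ge0 // ltW.
  by apply: ler_pM => //; apply: ltW.
rewrite -p12; field.
by rewrite !gt_eqF.
Qed.

End Growth.

Lemma level_large (R : realType) (beta : R) n r : 0 < beta ->
  2 * n%:R + 4 <= powR 2 (beta * r%:R) -> (8 * 4 ^ n <= kRHA beta r)%N.
Proof.
move=> b0 h; rewrite -(ler_nat R); apply: le_trans (k_ge b0 r).
have h1 : (2 : R) ^+ (2 * n + 4) <= expR (powR 2 (beta * r%:R)).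
  apply: (@le_trans _ _ (expR ((2 * n + 4)%:R * 1))).
    rewrite expRM_natl lerXn2r ?nnegrE ?expR_ge0 //.
    by have := @expR_ge1Dx R 1; rewrite -[1 + 1]/2.
  by rewrite ler_expR mulr1 natrD natrM.
rewrite natrM natrX; move: h1; rewrite exprD exprM.
have -> : (2 : R) ^+ 2 = 4 by ring.
have -> : (2 : R) ^+ 4 = 16 by ring.
lra.
Qed.

Theorem theorem7 (R : realType) (beta : R) (hbeta : 0 < beta < 1)
  (hk : forall n, (1 <= n)%N ->
          (kRHA beta n.-1 <= kRHA beta n <= (kRHA beta n.-1) ^ 2)%N)
  (dO : measure_display) (Om : measurableType dO) (P : probability Om R)
  (S : forall n, Om -> Sset (kRHA beta) n) (Cc : forall n, Om -> 'I_(kRHA beta n))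
  (hlaw : RHA_law P S Cc)
  (mu : probability (Xi (kRHA beta 0)) R)
  (hmu : forall m (x : m.-tuple (Alph (kRHA beta 0))),
     (fun N : nat => N%:R^-1 * \sum_(1 <= i < N.+1) window_prob P S Cc x i)
        @ \oo --> fine (mu (cyl x)))
  (F : Xi (kRHA beta 0) -> probability (Xi (kRHA beta 0)) R)
  (hF : is_reg_cond_prob_inv mu F)
  (C : forall m, m.-tuple (Alph (kRHA beta 0)) -> seq bool)
  (hC : UD_block_code C) :
  exists c : R, 0 < c /\ exists M : nat, forall m : nat, (M <= m)%N ->
    ((c * (powR m%:R (1 - beta) / powR (ln m%:R) (beta^-1 - 1)))%:E
       <= \int[mu]_xi code_ratio F C m xi)%E.
Proof.
have /andP[b0 b1] := hbeta; set k := kRHA beta in hk S Cc hlaw mu hmu F hF C hC *.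
have k2 n : (2 <= k n)%N by exact: k_ge2.
have k0 n : (0 < k n)%N by exact: leq_trans (k2 n).
have kle n : (k n.+1 <= k n ^ 2)%N by have /andP[] := hk n.+1 isT.
have kmono n : (k n <= k n.+1)%N by have /andP[] := hk n.+1 isT.
have l2 := ln2_ge R; have bl0 : 0 < beta * ln 2 by rewrite mulr_gt0 //; lra.
pose C1 : R := (beta * ln 2)^-1 + 2.
have C10 : 0 < C1 by rewrite addr_gt0 // invr_gt0.
pose G : R := 4 * 2 * powR 8 (beta^-1 - 1).
have G0 : 0 < G by rewrite mulr_gt0 // powR_gt0.
exists (8 * C1 * G)^-1; split; first by rewrite invr_gt0 !mulr_gt0.
have [N0 hN0] := ln_affine_small bl0.
exists (2 ^ (maxn N0 6).+1)%N => m Mm.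
have m0 : (0 < m)%N by apply: leq_trans Mm; rewrite expn_gt0.
pose n := (trunc_log 2 m).-1.
have tN : ((maxn N0 6).+1 <= trunc_log 2 m)%N by rewrite trunc_log_max.
have nE : n.+1 = trunc_log 2 m by rewrite prednK // (leq_trans _ tN).
have nN : (maxn N0 6 <= n)%N by rewrite -ltnS nE.
have m12 : (2 ^ n.+1 <= m < 2 ^ n.+2)%N by rewrite nE; apply: trunc_log_bounds.
have n6 : 6 <= n%:R :> R.
  by rewrite (ler_nat R 6) (leq_trans _ nN) // leq_maxr.
have [r [zr r2 rt]] := @level_exists R beta b0 (2 * n%:R + 4) ltac:(lra).
have rn : (r <= n)%N.
  rewrite -(ler_nat R); apply: le_trans rt _; apply: hN0.
  by rewrite (leq_trans _ nN) // leq_maxl.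
have kr8 : (8 * 4 ^ (n - r) <= k r)%N.
  apply: leq_trans (level_large b0 zr).
  by rewrite leq_mul2l leq_exp2l // leq_subr.
pose q := (n - r)%N; pose Q := (2 ^ q)%N.
pose L0 := trunc_log 2 (k r ^ Q); pose L := (L0 - 3)%N.
have kQ0 : (0 < k r ^ Q)%N by rewrite expn_gt0 k0.
have /andP[L1 L2] := trunc_log_bounds (isT : (1 < 2)%N) kQ0; rewrite -/L0 in L1 L2.
have kR0 : 0 < (k r)%:R :> R by rewrite ltr0n.
have Qy : 4^-1 * (2 ^+ q * powR 2 (beta * r%:R)) <= L%:R.
  have h1 : ln ((k r ^ Q)%:R : R) <= (L0%:R + 1) * ln 2.
    rewrite natr1 mulr_natl -lnXn // ler_ln ?posrE ?ltr0n ?exprn_gt0 //.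
    by rewrite -natrX ler_nat ltnW.
  rewrite natrX lnXn // -[ln _ *+ Q]mulr_natl in h1.
  have h2 := lnk_ge b0 r; rewrite -/k in h2.
  have Q1 : 1 <= Q%:R :> R by rewrite (ler_nat R 1) expn_gt0.
  have h3 := ler_wpM2l (ler0n R Q) h2.
  have h4 : (L0%:R + 1) * ln 2 <= L0%:R + 1 :> R.
    by rewrite ler_piMr ?ln2_le1 // addr_ge0.
  have h5 : L0%:R <= L%:R + 3 :> R by rewrite -natrD ler_nat addnC -leq_subLR.
  have h6 := ler_wpM2r (le_trans ler01 (y_ge1 b0 r)) Q1.
  rewrite -natrX -/Q; set yr := powR 2 _ in zr h2 h3 h6 *; lra.
pose A := [pred x : m.-tuple (Alph (k 0)) | (size (C m x) < L)%N].
have cA : (#|A| <= 2 ^ L)%N by apply: card_short_codes; have [] := hC m.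
have muA : \sum_(x | (size (C m x) < L)%N) prob mu (cyl x) <= 2^-1.
  have h := @mean_le R k dO Om P S Cc hlaw k0 kle kmono mu hmu m r q A.
  rewrite subnKC // -expnS in h; have /andP[m1 _] := m12.
  apply: le_trans (h m1 _) _; first by apply: leq_trans kr8; rewrite leq_mul2r orbT.
  have h1 : 8 * (4 ^ q)%:R <= (k r)%:R :> R by rewrite -natrM ler_nat.
  have h2 : 2 * (4 ^ q)%:R / (k r)%:R <= 4^-1 :> R by rewrite ler_pdivrMr //; lra.
  have kQR : 0 < (k r)%:R ^+ Q :> R by rewrite exprn_gt0.
  suff h3 : #|A|%:R * (2 / (k r)%:R ^+ (2 ^ q)) <= 4^-1 :> R by lra.
  rewrite mulrA ler_pdivrMr //.
  have Lge : (3 <= L0)%N.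
    apply: trunc_log_max => //; apply: leq_trans (_ : k r <= _)%N.
      by apply: leq_trans kr8; rewrite leq_pmulr // expn_gt0.
    by rewrite -[X in (X <= _)%N]expn1 leq_pexp2l // expn_gt0.
  have : (#|A| * 8 <= k r ^ Q)%N.
    apply: leq_trans L1; rewrite -(subnK Lge) expnD leq_mul2r /=.
    exact: cA.
  by rewrite -(ler_nat R) natrM natrX -/Q; lra.
have Elen := mean_length_ge (fun x => prob_ge0 mu (cyl x)) _ muA.
have {}Elen : L%:R / 2 <=
    \sum_(x : m.-tuple (Alph (k 0))) prob mu (cyl x) * (size (C m x))%:R.
  apply: Elen.
  rewrite -(probT mu) (prob_split mu (@measurableT _ (Xi (k 0))) (@dmeas_word_at (k 0) 0 m)).
  by apply: eq_bigr => x _; rewrite cylE setTI.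
pose K := (2 ^ n.+2 * k n.+2 ^ 2)%N.
have K1 : (1 < K)%N.
  rewrite /K (@leq_trans (2 * 1)%N) // leq_mul ?expn_gt0 ?k0 //.
  by rewrite expnS leq_pmulr // expn_gt0.
have few0 : mu.-negligible (~` few_words (k0 := k 0) m K).
  have := @ae_few_words R k dO Om P S Cc k0 mu hmu n.+2 m; apply.
  by have /andP[_ /ltnW] := m12.
have hlast := last_occurrence0 hlaw k0 hmu.
apply: le_trans (integral_code_ratio_ge hF hlast C K1 few0).
rewrite lee_fin; have lK := ln_supp_le b0 n.+2; rewrite -/k -/K -/C1 in lK.
have lK0 : 0 < ln K%:R :> R by rewrite ln_gt0 // ltr1n.
have g := growth_bound b0 b1 rn m12 r2; rewrite -/G in g.
have y0 : 0 < powR 2 (beta * n.+2%:R) :> R by rewrite powR_gt0.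
set y' := powR 2 (beta * n.+2%:R) in lK g y0.
set X := 2 ^+ (n - r) * _ in g; rewrite -/q -/X in Qy.
have X0 : 0 <= X by rewrite mulr_ge0 ?exprn_ge0 ?powR_ge0.
set T := _ / _ in g *.
apply: (@le_trans _ _ (X / 8 / (C1 * y'))).
  rewrite mulrC ler_pdivrMr ?mulr_gt0 //; apply: le_trans g _.
  rewrite le_eqVlt; apply/orP; left; apply/eqP; field.
  by rewrite !gt_eqF.
apply: ler_pM => //; first by rewrite divr_ge0.
- by rewrite invr_ge0 mulr_ge0 // ltW.
- by apply: le_trans Elen; lra.
- by rewrite lef_pV2 ?posrE ?mulr_gt0.
Qed.
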